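(* The Intersection Non-emptiness problem for totally star-free NFAs accepting star-free commutative languages (i.e., commutative languages in $\mathsf{ST}_{3/2}$) is in $\mathsf{XP}$ with the size of the alphabet as the parameter; that is, it can be solved in time $N^{f(|\Sigma|)}$ for some computable function $f$, where $N$ is the input size.
   Context: An NFA $A=(Q,\Sigma,\delta,q_0,F)$ (single initial state, no $\varepsilon$-transitions) is totally star-free if for all states $q,p\in Q$ the language accepted by $(Q,\Sigma,\delta,q,\{p\})$ is star-free. Star-free languages are those obtained from finite languages by union, concatenation and complement. A language is commutative if $uabv\in L$ implies $ubav\in L$ for all letters $a,b$ and words $u,v$. $\mathsf{ST}_{3/2}$ consists of finite unions of languages $\Sigma_0^*a_1\Sigma_1^*\cdots a_k\Sigma_k^*$ ($a_i\in\Sigma$, $\Sigma_i\subseteq\Sigma$). The problem: given totally star-free NFAs $A_1,\dots,A_m$ over a common alphabet $\Sigma$, promised each accepts a star-free commutative language, decide whether $\bigcap_i L(A_i)\neq\emptyset$. *)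

(* Defs.v *)
From mathcomp Require Import all_boot.
Set Implicit Arguments. Unset Strict Implicit. Unset Printing Implicit Defensive.

Definition lang (k : nat) := seq 'I_k -> Prop.

Inductive star_free (k : nat) : lang k -> Prop :=
| sf_fin (s : seq (seq 'I_k)) : star_free (fun w => w \in s)
| sf_union (L1 L2 : lang k) :
    star_free L1 -> star_free L2 -> star_free (fun w => L1 w \/ L2 w)
| sf_concat (L1 L2 : lang k) :
    star_free L1 -> star_free L2 ->
    star_free (fun w => exists u v, w = u ++ v /\ L1 u /\ L2 v)
| sf_compl (L : lang k) : star_free L -> star_free (fun w => ~ L w)
| sf_ext (L1 L2 : lang k) : star_free L1 -> (forall w, L1 w <-> L2 w) -> star_free L2.

Definition commutative_lang (k : nat) (L : lang k) : Prop :=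
  forall (u v : seq 'I_k) (a b : 'I_k), L (u ++ a :: b :: v) -> L (u ++ b :: a :: v).

Record nfa (k : nat) := NFA {
  nfa_n : nat;
  nfa_init : 'I_nfa_n.+1;
  nfa_final : {set 'I_nfa_n.+1};
  nfa_delta : 'I_nfa_n.+1 -> 'I_k -> {set 'I_nfa_n.+1} }.

Fixpoint nfa_reach (k : nat) (A : nfa k) (S : {set 'I_(nfa_n A).+1}) (w : seq 'I_k)
  : {set 'I_(nfa_n A).+1} :=
  match w with
  | [::] => S
  | a :: w' => nfa_reach (\bigcup_(q in S) nfa_delta q a) w'
  end.

Definition nfa_lang_from (k : nat) (A : nfa k) (q : 'I_(nfa_n A).+1)
  (P : {set 'I_(nfa_n A).+1}) : lang k :=
  fun w => [exists p in nfa_reach [set q] w, p \in P].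

Definition nfa_lang (k : nat) (A : nfa k) : lang k :=
  nfa_lang_from (nfa_init A) (nfa_final A).

Definition totally_star_free (k : nat) (A : nfa k) : Prop :=
  forall q p : 'I_(nfa_n A).+1, star_free (nfa_lang_from q [set p]).

Definition c0 : 'I_3 := @Ordinal 3 0 isT.
Definition c1 : 'I_3 := @Ordinal 3 1 isT.
Definition csep : 'I_3 := @Ordinal 3 2 isT.
Definition cbit (b : bool) : 'I_3 := if b then c1 else c0.
Definition unary (n : nat) : seq 'I_3 := nseq n c1.

Definition enc_nfa (k : nat) (A : nfa k) : seq 'I_3 :=
  unary (nfa_n A).+1 ++ [:: csep] ++
  unary (nfa_init A) ++ [:: csep] ++
  [seq cbit (q \in nfa_final A) | q <- enum 'I_(nfa_n A).+1] ++ [:: csep] ++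
  flatten [seq [seq cbit (p \in nfa_delta q a) | a <- enum 'I_k, p <- enum 'I_(nfa_n A).+1]
          | q <- enum 'I_(nfa_n A).+1] ++ [:: csep].

Definition encode (k : nat) (As : seq (nfa k)) : seq 'I_3 :=
  unary k ++ [:: csep] ++ flatten (map (@enc_nfa k) As).

(* States 'I_(tm_nq).+1, tape symbols 'I_(tm_ng).+4; symbol 0 is blank,   *)
(* symbols 1,2,3 encode the input letters 0,1,#.                          *)

Inductive move := MLeft | MRight | MStay.

Record TM := MkTM {
  tm_nq : nat;
  tm_ng : nat;
  tm_start : 'I_tm_nq.+1;
  tm_acc : 'I_tm_nq.+1;
  tm_rej : 'I_tm_nq.+1;
  tm_delta : 'I_tm_nq.+1 -> 'I_tm_ng.+4 -> 'I_tm_nq.+1 * 'I_tm_ng.+4 * move }.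

Definition tm_sym (M : TM) := 'I_(tm_ng M).+4.

(* configuration: state, cells left of head (nearest first), head cell, cells right *)
Definition tm_config (M : TM) :=
  ('I_(tm_nq M).+1 * seq (tm_sym M) * tm_sym M * seq (tm_sym M))%type.

Definition tm_blank (M : TM) : tm_sym M := ord0.
Definition tm_in (M : TM) (s : 'I_3) : tm_sym M := inord s.+1.

Definition tm_state (M : TM) (c : tm_config M) : 'I_(tm_nq M).+1 :=
  let: (q, _, _, _) := c in q.

Definition tm_tape (M : TM) (c : tm_config M) : seq (tm_sym M) :=
  let: (_, l, x, r) := c in rev l ++ x :: r.

Definition tm_step (M : TM) (c : tm_config M) : tm_config M :=
  let: (q, l, x, r) := c in
  if (q == tm_acc M) || (q == tm_rej M) then c else
  let: (q', s, mv) := tm_delta q x in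
  match mv with
  | MStay => (q', l, s, r)
  | MLeft => match l with
             | [::] => (q', [::], tm_blank M, s :: r)
             | y :: l' => (q', l', y, s :: r)
             end
  | MRight => match r with
              | [::] => (q', s :: l, tm_blank M, [::])
              | y :: r' => (q', s :: l, y, r')
              end
  end.

Definition tm_run (M : TM) (t : nat) (c : tm_config M) : tm_config M :=
  iter t (@tm_step M) c.

Definition tm_init (M : TM) (w : seq 'I_3) : tm_config M :=
  let w' := map (@tm_in M) w in
  (tm_start M, [::], head (tm_blank M) w', behead w').

Definition tm_computes (M : TM) (f : nat -> nat) : Prop :=
  forall n, exists t,
    let c := tm_run t (tm_init M (unary n)) in
    tm_state c = tm_acc M /\ count_mem (tm_in M c1) (tm_tape c) = f n.

(* Main.v *)
Require Import Defs.
From HB Require Import structures.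
From mathcomp Require Import all_boot zify.
From Stdlib Require List.
Set Implicit Arguments. Unset Strict Implicit. Unset Printing Implicit Defensive.

(* Star-free languages are aperiodic, so in a totally star-free NFA with [n] states the relation
   "reachable by reading [a^e]" is eventually constant in [e]; removing and inserting cycles
   modulo [n!] shows that it is constant already for [e >= 2n^2].  A commutative language
   contains a word iff it contains its sorted rearrangement [a_1^{e_1} ... a_k^{e_k}], so a
   nonempty intersection contains such a word with all [e_i] below [B = 2N^2 + 1].  These words
   are enumerated by reading the base-[B] digits of a counter [E < B^k], and each of them is
   checked by computing the set of reachable states of every automaton.

   The search is a while-program over registers (natural numbers), the read-only input and two
   bit arrays.  A Turing machine keeps a register as a mark on a track of its tape and the bit
   arrays as two further tracks, so that every operation is one left-to-right pass of a finite
   transducer.  All loops run at most [X = B^(k+1)] times, hence the running time is polynomial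
   in [X], which is [N^{O(k)}]. *)

(** * A while language *)

(** The threshold given by aperiodicity comes from a star-free expression and is not bounded in
    terms of the number [n] of states. It serves only to change the residue of a very large exponent
    modulo [n!]; the cycle argument then brings the exponent down. The modulus is [n!] because the
    cycles found have length at most [n], which varies with the walk, and [2n^2] pays for the two
    pieces of a walk before and after its cycle. Total star-freeness allows this for each pair of
    states separately, so that every block of a sorted word can be shortened from whatever set of
    states has been reached before it. The shortening depends on the word and on [B] only, hence one
    word serves all automata.

    A single machine has to handle every alphabet. The program is therefore fixed, its nesting of
    loops gives a polynomial in [X] of fixed degree, and [k] enters the running time through [X]
    alone. This makes the exponent linear in [k], with a slope known only to exist; a family of
    machines indexed by the slope shows that it is computable. *)

Section Language.

Variable reg : finType.

(** Tests and updates share one type because the same kind of sweep performs both. Executed as a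
    statement, a test leaves the store unchanged. [cur] and [nxt] will hold the sets of states
    reached before and after a letter. *)
Inductive op :=
| Inc (i : reg) | Zero (i : reg) | Mov (i j : reg)
| Eq (i j : reg) | Sym (a : nat) (i : reg) | Get (i : reg)
| Put (i : reg) | Flush.

Record store := Store { rg : reg -> nat; cur : nat -> bool; nxt : nat -> bool }.

Definition setr (s : store) (i : reg) (v : nat) : store :=
  Store (fun j => if j == i then v else rg s j) (cur s) (nxt s).

Definition store0 : store := Store (fun _ => 0) (fun _ => false) (fun _ => false).

Definition exec_op (o : op) (s : store) : store :=
  match o with
  | Inc i => setr s i (rg s i).+1
  | Zero i => setr s i 0
  | Mov i j => setr s i (rg s j)
  | Put i => Store (rg s) (cur s) (fun p => (p == rg s i) || nxt s p)
  | Flush => Store (rg s) (nxt s) (fun _ => false)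
  | _ => s
  end.

Inductive prog :=
| Do (o : op)
| Seq (p q : prog)
| If (o : op) (p q : prog)
| While (b : bool) (o : op) (p : prog).

Definition For (i j : reg) (p : prog) : prog :=
  Seq (Do (Zero i)) (While false (Eq i j) (Seq p (Do (Inc i)))).

(** Bounds the number of executed operations, each of which costs one sweep: both branches of an
    [If] are charged, and a [While] pays for the last, failing test. *)
Fixpoint tcost (X : nat) (p : prog) : nat :=
  match p with
  | Do _ => 1
  | Seq p q => tcost X p + tcost X q
  | If _ p q => (tcost X p + tcost X q).+1
  | While _ _ p => (X * (tcost X p).+1).+1
  end.

(** [C] and [D] depend on the program only, hence neither on the input nor on the alphabet. *)
Lemma tcost_poly (p : prog) : exists C D, forall X, tcost X p <= C * X.+1 ^ D.
Proof.
elim: p => [o|p [C1 [D1 h1]] q [C2 [D2 h2]]|o p [C1 [D1 h1]] q [C2 [D2 h2]]|b o p [C [D h]]].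
- by exists 1, 0.
- exists (C1 + C2), (D1 + D2) => X /=; rewrite mulnDl leq_add //.
    by apply: leq_trans (h1 X) _; rewrite leq_mul2l leq_pexp2l ?leq_addr ?orbT.
  by apply: leq_trans (h2 X) _; rewrite leq_mul2l leq_pexp2l ?leq_addl ?orbT.
- exists (C1 + C2).+1, (D1 + D2) => X /=; rewrite mulSn mulnDl -add1n leq_add ?expn_gt0 //.
  rewrite leq_add //.
    by apply: leq_trans (h1 X) _; rewrite leq_mul2l leq_pexp2l ?leq_addr ?orbT.
  by apply: leq_trans (h2 X) _; rewrite leq_mul2l leq_pexp2l ?leq_addl ?orbT.
exists C.+1, D.+1 => X /=; rewrite expnS mulnCA.
have h' : (tcost X p).+1 <= C.+1 * X.+1 ^ D.
  by rewrite mulSn -add1n leq_add ?expn_gt0.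
apply: (@leq_trans (X.+1 * (tcost X p).+1)); last by rewrite leq_mul2l h'.
by rewrite mulSn addSn ltnS leq_addl.
Qed.

Section Input.

Variable w : seq 'I_3.

(* 0 stands for the blank beyond the input. *)
Definition inp (j : nat) : nat := nth 0 [seq (val a).+1 | a <- w] j.

Definition test (o : op) (s : store) : bool :=
  match o with
  | Eq i j => rg s i == rg s j
  | Sym a i => inp (rg s i) == a
  | Get i => cur s (rg s i)
  | _ => false
  end.

(* [None] if some loop needs more than [X] iterations. *)
Fixpoint exec (X : nat) (p : prog) (s : store) : option store :=
  match p with
  | Do o => Some (exec_op o s)
  | Seq p q => obind (exec X q) (exec X p s)
  | If o p q => if test o s then exec X p s else exec X q s
  | While b o p =>
    (fix loop n s :=
       if test o s == b then
         if n is n'.+1 then obind (loop n') (exec X p s) else None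
       else Some s) X s
  end.

(** * Framing and total correctness *)

Fixpoint mods (p : prog) : seq reg :=
  match p with
  | Do (Inc i) | Do (Zero i) | Do (Mov i _) => [:: i]
  | Do _ => [::]
  | Seq p q | If _ p q => mods p ++ mods q
  | While _ _ p => mods p
  end.

Fixpoint flushes (p : prog) : bool :=
  match p with
  | Do Flush => true
  | Do _ => false
  | Seq p q | If _ p q => flushes p || flushes q
  | While _ _ p => flushes p
  end.

Fixpoint puts (p : prog) : bool :=
  match p with
  | Do (Put _) => true
  | Do _ => false
  | Seq p q | If _ p q => puts p || puts q
  | While _ _ p => puts p
  end.

(** What a program leaves alone is read off its syntax, so specifications mention only what changes.
    [Flush] affects both arrays, [Put] only [nxt]. *)
Definition frame (p : prog) (s s' : store) : Prop :=
  [/\ forall r, r \notin mods p -> rg s' r = rg s r,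
      ~~ flushes p -> cur s' = cur s &
      ~~ flushes p -> ~~ puts p -> nxt s' = nxt s].

Lemma frame_trans p s1 s2 s3 : frame p s1 s2 -> frame p s2 s3 -> frame p s1 s3.
Proof.
move=> [a1 b1 c1] [a2 b2 c2]; split=> [r h|h|h h'].
- by rewrite a2 ?a1.
- by rewrite b2 ?b1.
- by rewrite c2 ?c1.
Qed.

Lemma frame_sub p q s s' : {subset mods p <= mods q} ->
  (flushes p -> flushes q) -> (puts p -> puts q) -> frame p s s' -> frame q s s'.
Proof.
move=> hm hf hp [a b c]; split=> [r h|h|h h'].
- by apply: a; apply: contra h => /hm.
- by apply: b; apply: contra h.
- by apply: c; [apply: contra h | apply: contra h'].
Qed.

Lemma exec_frame X p s s' : exec X p s = Some s' -> frame p s s'.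
Proof.
elim: p s s' => [o|p IHp q IHq|o p IHp q IHq|b o p IHp] s s' /=.
- case=> <-; split; try by case: o.
  by case: o => //= [i r|i r|i j r]; rewrite inE => /negPf ->.
- case e: (exec X p s) => [s1|] //= /IHq h2; move/IHp: e => h1.
  apply: (@frame_trans _ _ s1); [apply: frame_sub h1|apply: frame_sub h2] => /=;
    by [move=> r h; rewrite mem_cat h ?orbT | move=> ->; rewrite ?orbT].
- by case: ifP => _ => [/IHp|/IHq]; apply: frame_sub => /=;
    by [move=> r h; rewrite mem_cat h ?orbT | move=> ->; rewrite ?orbT].
have: forall n s, (fix loop n s :=
       if test o s == b then
         if n is n'.+1 then obind (loop n') (exec X p s) else None
       else Some s) n s = Some s' -> frame (While b o p) s s'.
  elim=> [|n IHn] {}s; case: ifP => // _; try by case=> <-.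
  by case e: (exec X p s) => [s1|] //= /IHn; apply: frame_trans; apply: IHp e.
by apply.
Qed.

(** Total correctness including the resource bound: no loop needs more than [X] rounds. *)
Definition wp (X : nat) (p : prog) (s : store) (Q : store -> Prop) : Prop :=
  exists2 s', exec X p s = Some s' & Q s'.

Lemma wp_mono X p s (Q R : store -> Prop) :
  wp X p s Q -> (forall s', frame p s s' -> Q s' -> R s') -> wp X p s R.
Proof. by case=> s' e q h; exists s' => //; apply: h q; apply: exec_frame e. Qed.

Lemma wp_do X o s (Q : store -> Prop) : Q (exec_op o s) -> wp X (Do o) s Q.
Proof. by move=> q; exists (exec_op o s). Qed.

Lemma wp_seq X p q s Q : wp X p s (fun s' => wp X q s' Q) -> wp X (Seq p q) s Q.
Proof. by case=> s1 e [s2 e2 h]; exists s2; rewrite //= e. Qed.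

Lemma wp_cat X p q s (P Q : store -> Prop) :
  wp X p s P -> (forall s', frame p s s' -> P s' -> wp X q s' Q) -> wp X (Seq p q) s Q.
Proof. by move=> h1 h2; apply: wp_seq; apply: wp_mono h1 h2. Qed.

Lemma wp_if X o p q s Q :
  (test o s -> wp X p s Q) -> (~~ test o s -> wp X q s Q) -> wp X (If o p q) s Q.
Proof.
move=> h1 h2; rewrite /wp /=; case: ifP => [/h1|/negbT /h2] [s' e h]; by exists s'.
Qed.

Lemma wp_while X b o p s n (I : nat -> store -> Prop) :
  n <= X -> I 0 s ->
  (forall i s', i < n -> I i s' -> frame (While b o p) s s' ->
     test o s' = b /\ wp X p s' (I i.+1)) ->
  (forall s', I n s' -> frame (While b o p) s s' -> test o s' = ~~ b) ->
  wp X (While b o p) s (I n).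
Proof.
move=> nX I0 Ib Ie.
(* Induction on the number [m] of rounds still to come; the fuel [X - n] that is never spent is
   carried along. *)
have: forall m i s', i + m = n -> m <= X -> I i s' -> frame (While b o p) s s' ->
   exists2 s'', (fix loop n s :=
       if test o s == b then
         if n is n'.+1 then obind (loop n') (exec X p s) else None
       else Some s) (m + (X - n)) s' = Some s'' & I n s''.
  elim=> [|m IHm] i s' im mX Ii fr.
    rewrite addn0 in im; subst i; exists s' => //.
    by case: (_ + _) => [|n']; rewrite (Ie _ Ii fr); case: (b).
  have lin : i < n by rewrite -im addnS ltnS leq_addr.
  have [t [s1 e h1]] := Ib i s' lin Ii fr.
  rewrite addSn t eqxx e /=; apply: (IHm i.+1) => //; first by rewrite addSnnS.
    by apply: leq_trans mX.
  by apply: frame_trans fr _; apply: exec_frame e.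
move=> /(_ n 0 s erefl nX I0); rewrite subnKC //; apply.
by split.
Qed.

Lemma wp_for X i j p s n (I : nat -> store -> Prop) :
  n <= X -> i != j -> i \notin mods p -> j \notin mods p -> rg s j = n ->
  I 0 (setr s i 0) ->
  (forall v s', v < n -> I v s' -> rg s' i = v -> frame (For i j p) s s' ->
     wp X p s' (fun s'' => I v.+1 (setr s'' i v.+1))) ->
  wp X (For i j p) s (I n).
Proof.
move=> nX ij ip jp sj I0 Ib; apply: wp_seq; apply: wp_do.
have ffor s' : frame (While false (Eq i j) (Seq p (Do (Inc i)))) (exec_op (Zero i) s) s' ->
    frame (For i j p) s s' /\ rg s' j = n.
  move=> [h1 h2 h3]; split; first split.
  - move=> r /=; rewrite inE mem_cat !inE => h; rewrite h1 /=; last first.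
      by rewrite mem_cat inE; case: (r == i) h.
    by case: (r == i) h.
  - by move=> /h2.
  - by move=> /h3.
  - by rewrite h1 /= ?mem_cat ?inE ?negb_or ?jp eq_sym /= ?(negPf ij) // eq_sym (negPf ij).
apply: wp_mono; first apply: (@wp_while X false (Eq i j) _ _ n
   (fun v s' => I v s' /\ rg s' i = v)) => //=.
- by rewrite eqxx.
- move=> v s' vn [Iv iv] /ffor [fr jn].
  split; first by rewrite iv jn; apply/eqP => e; rewrite e ltnn in vn.
  apply: wp_cat (Ib v s' vn Iv iv fr) _ => s'' [f1 _ _] h; apply: wp_do.
  by rewrite /= eqxx f1 // iv.
- by move=> s' [In iv] /ffor [fr jn]; rewrite iv jn eqxx.
by move=> s' _ [].
Qed.


End Input.

End Language.

(** * Compilation to Turing machines *)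

Lemma tm_runS (M : TM) t (c : tm_config M) : tm_run t.+1 c = tm_run t (tm_step c).
Proof. exact: iterSr. Qed.

Lemma tm_runD (M : TM) t u (c : tm_config M) : tm_run (t + u) c = tm_run u (tm_run t c).
Proof. by rewrite addnC; exact: iterD. Qed.

(** * Control flow of a program *)

Section Machine.

Variable reg : finType.
Implicit Types (o : op reg) (s : store reg) (p : prog reg).

(** One label per operation; [None] is the test heading an [If] or a [While]. *)
Fixpoint label p : finType :=
  match p with
  | Do _ => unit
  | Seq p q => (label p + label q)%type
  | If _ p q => option (label p + label q)
  | While _ _ p => option (label p)
  end.

Fixpoint entry p : label p :=
  match p with
  | Do _ => tt
  | Seq p q => inl (entry p)
  | If _ p q => None
  | While _ _ p => None
  end.

Fixpoint op_at p : label p -> op reg :=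
  match p return label p -> op reg with
  | Do o => fun _ => o
  | Seq p q => fun l => match l with inl l => op_at l | inr l => op_at l end
  | If o p q => fun l =>
      match l with None => o | Some (inl l) => op_at l | Some (inr l) => op_at l end
  | While b o p => fun l => if l is Some l then op_at l else o
  end.

Fixpoint next p : label p -> bool -> option (label p) :=
  match p return label p -> bool -> option (label p) with
  | Do _ => fun _ _ => None
  | Seq p q => fun l r =>
      match l with
      | inl l => Some (if next l r is Some l' then inl l' else inr (entry q))
      | inr l => omap inr (next l r)
      end
  | If o p q => fun l r =>
      match l with
      | None => Some (Some (if r then inl (entry p) else inr (entry q)))
      | Some (inl l) => omap (fun l => Some (inl l)) (next l r)
      | Some (inr l) => omap (fun l => Some (inr l)) (next l r)
      end
  | While b o p => fun l r =>
      match l with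
      | None => if r == b then Some (Some (entry p)) else None
      | Some l => Some (next l r)
      end
  end.

Section Input.

Variable w : seq 'I_3.

(** Runs to the exit: the number counts operations, and the final boolean is the outcome of the last
    one, on which acceptance will depend. *)
Inductive flow p : label p -> store reg -> nat -> store reg -> bool -> Prop :=
| flow_exit l s r :
    test w (op_at l) s = r -> next l r = None -> flow l s 1 (exec_op (op_at l) s) r
| flow_step l l' s n s' r r' :
    test w (op_at l) s = r -> next l r = Some l' ->
    flow l' (exec_op (op_at l) s) n s' r' -> flow l s n.+1 s' r'.

Lemma flow_embed p q (f : label p -> label q) (l : label p) s n s' r :
  (forall l, op_at (f l) = op_at l) ->
  (forall l r, next (f l) r = omap f (next l r)) ->
  flow l s n s' r -> flow (f l) s n s' r.
Proof.
move=> fo fn; elim=> {l s n s' r} [l s r e nl|l l' s n s1 r r1 e nl _ IH].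
  by rewrite -fo; apply: flow_exit; rewrite ?fo // fn nl.
by rewrite -fo in e IH; apply: (flow_step e _ IH); rewrite fn nl.
Qed.

Lemma flow_seq p q (l : label p) s n s1 r m s' r' :
  flow l s n s1 r -> flow (entry q) s1 m s' r' ->
  flow (inl l : label (Seq p q)) s (n + m) s' r'.
Proof.
move=> h h2'; have h2 : flow (inr (entry q) : label (Seq p q)) s1 m s' r'.
  exact: (@flow_embed q (Seq p q) inr) h2'.
elim: h => {l s n s1 r h2'} [l s r e nl|l l' s n s1 r r1 e nl _ IH] in h2 *.
  by rewrite add1n; apply: (@flow_step (Seq p q) (inl l) (inr (entry q)) _ _ _ _ _ e); rewrite //= nl.
by rewrite addSn; apply: (@flow_step (Seq p q) (inl l) (inl l') _ _ _ _ _ e _ (IH h2)); rewrite /= nl.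
Qed.

Lemma flow_loop b o p (l : label p) s n s1 r m s' r' :
  flow l s n s1 r -> flow (None : label (While b o p)) s1 m s' r' ->
  flow (Some l : label (While b o p)) s (n + m) s' r'.
Proof.
move=> h h2; elim: h => {l s n s1 r} [l s r e nl|l l' s n s1 r r1 e nl _ IH] in h2 *.
  by rewrite add1n; apply: (@flow_step (While b o p) (Some l) None _ _ _ _ _ e); rewrite //= nl.
rewrite addSn.
by apply: (@flow_step (While b o p) (Some l) (Some l') _ _ _ _ _ e _ (IH h2)); rewrite /= nl.
Qed.

Definition is_test o : bool := if o is (Eq _ _ | Sym _ _ | Get _) then true else false.

(** [flow] executes every operation it passes, whereas [exec] only evaluates guards; the two agree
    when guards are tests. *)
Fixpoint wf p : bool :=
  match p with
  | Do _ => true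
  | Seq p q => wf p && wf q
  | If o p q => [&& is_test o, wf p & wf q]
  | While _ o p => is_test o && wf p
  end.

Lemma is_test_exec o s : is_test o -> exec_op o s = s.
Proof. by case: o. Qed.

Lemma exec_flow X p s s' : wf p -> exec w X p s = Some s' ->
  exists n r, n <= tcost X p /\ flow (entry p) s n s' r.
Proof.
elim: p s s' => [o|p IHp q IHq|o p IHp q IHq|b o p IHp] s s' /=.
- move=> _ [<-]; exists 1, (test w o s); split=> //.
  by apply: (@flow_exit (Do o) tt).
- case/andP=> wp wq; case e: (exec w X p s) => [s1|] //= /(IHq _ _ wq) [m [r' [hm h2]]].
  case: (IHp _ _ wp e) => n [r [hn h1]].
  by exists (n + m), r'; split; [rewrite leq_add | apply: flow_seq h1 h2].
- case/and3P=> wo wp wq; case e: (test w o s) => h0; [have := IHp _ _ wp h0|have := IHq _ _ wq h0].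
  + case=> n [r [hn h]]; exists n.+1, r; split; first by rewrite ltnS (leq_trans hn) ?leq_addr.
    apply: (@flow_step (If o p q) None (Some (inl (entry p))) _ _ _ _ _ e) => //=.
    rewrite is_test_exec //.
    by apply: (@flow_embed p (If o p q) (fun l => Some (inl l))) h.
  + case=> n [r [hn h]]; exists n.+1, r; split; first by rewrite ltnS (leq_trans hn) ?leq_addl.
    apply: (@flow_step (If o p q) None (Some (inr (entry q))) _ _ _ _ _ e) => //=.
    rewrite is_test_exec //.
    by apply: (@flow_embed q (If o p q) (fun l => Some (inr l))) h.
(* Only the fuel and the factor counting rounds are generalized; the bound for the body keeps
   [X]. *)
case/andP=> wo wp; move: {2 3}X => n.
elim: n s => [|n IHn] s /=; case e: (test w o s == b) => //.
- case=> <-; exists 1, (test w o s); split=> //.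
  rewrite -{2}(is_test_exec s wo).
  by apply: (@flow_exit (While b o p) None); rewrite //= e.
- case e1: (exec w X p s) => [s1|] //= /IHn [m [r' [hm h2]]].
  case: (IHp _ _ wp e1) => k [r [hk h1]].
  exists (k + m).+1, r'; split.
    by rewrite ltnS mulSn; lia.
  apply: (@flow_step (While b o p) None (Some (entry p))); [exact: erefl|by rewrite /= e|].
  by rewrite /= is_test_exec //; apply: flow_loop h1 h2.
- case=> <-; exists 1, (test w o s); split=> //.
  rewrite -{2}(is_test_exec s wo).
  by apply: (@flow_exit (While b o p) None); rewrite //= e.
Qed.

End Input.

(* A cell holds the input symbol (0 for blank), whether it is a visited cell beyond the
   input, whether it is the leftmost cell, which registers point to it, and one bit of each
   of the two arrays. *)
Definition cell : finType := ('I_4 * bool * bool * {ffun reg -> bool} * (bool * bool))%type.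

Definition raw (a : 'I_4) : cell := (a, false, false, [ffun => false], (false, false)).

Definition csym (c : cell) : 'I_4 := c.1.1.1.1.
(** A sweep turns at the first blank cell not yet visited and makes it visited. Each operation thus
    gains one cell, the room needed when a register grows by one. *)
Definition cend (c : cell) : bool := (csym c == ord0) && ~~ c.1.1.1.2.
Definition cfirst (c : cell) : bool := c.1.1.2.
Definition visit (c : cell) : cell := let: (a, _, z, m, x) := c in (a, true, z, m, x).
(** Applied once, to the leftmost cell: all marks on it means that all registers are 0. *)
Definition setup (c : cell) : cell :=
  let: (a, v, _, _, x) := c in (a, v, true, [ffun => true], x).

(* One cell of the left-to-right sweep which performs [o]; the bit [b] is the state of the
   transducer. *)
Definition sweep o (b : bool) (c : cell) : bool * cell :=
  let: (a, v, z, m, (x, y)) := c in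
  let mark i t := [ffun j => if j == i then t else m j] in
  match o with
  | Inc i => (m i, (a, v, z, mark i b, (x, y)))
  | Zero i => (b, (a, v, z, mark i z, (x, y)))
  | Mov i j => (b, (a, v, z, mark i (m j), (x, y)))
  | Eq i j => (b || m i && m j, c)
  | Sym e i => (b || m i && (a == e :> nat), c)
  | Get i => (b || m i && x, c)
  | Put i => (b, (a, v, z, m, (x, m i || y)))
  | Flush => (b, (a, v, z, m, (y, false)))
  end.

(** * The machine of a program *)

Section Compile.

Variable p : prog reg.

(** [None] is the start and [inl b] a halting state with outcome [b]. In [inr (l, d, b)] the
    operation at [l] is under way, [d] tells whether the head moves right, and [b] is the bit of the
    transducer, or on the way back the outcome of the test. *)
Definition state : finType := option (bool + label p * bool * bool).

Definition delta (q : state) (c : cell) : state * cell * move :=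
  match q with
  | None => (Some (inr (entry p, true, false)), setup c, MStay)
  | Some (inl _) => (q, c, MStay)
  | Some (inr (l, true, b)) =>
    if cend c then
      let: (b', c') := sweep (op_at l) b (visit c) in
      (Some (inr (l, false, is_test (op_at l) && b')), c', MLeft)
    else
      let: (b', c') := sweep (op_at l) b c in (Some (inr (l, true, b')), c', MRight)
  | Some (inr (l, false, b)) =>
    if cfirst c then
      (Some (if next l b is Some l' then inr (l', true, false) else inl b), c, MStay)
    else (q, c, MLeft)
  end.

Definition encq (q : state) : 'I_#|state|.+1 := inord (enum_rank q).
Definition decq (i : 'I_#|state|.+1) : state := nth None (enum state) i.
(** The codes below 4 belong to the blank and the input letters, which [decc] reads as raw cells. A
    raw cell has two codes, so only one direction of the inverse holds. *)
Definition encc (c : cell) : 'I_#|cell|.+4 := inord (4 + enum_rank c).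
Definition decc (i : 'I_#|cell|.+4) : cell :=
  if i < 4 then raw (inord i) else nth (raw ord0) (enum cell) (i - 4).

Lemma encqK : cancel encq decq.
Proof.
move=> q; rewrite /decq /encq inordK; first exact: nth_enum_rank.
by apply: leq_trans (ltn_ord _) _.
Qed.

Lemma enccK : cancel encc decc.
Proof.
move=> c; rewrite /decc /encc inordK; first by rewrite ltnNge leq_addr /= addKn nth_enum_rank.
by rewrite -[_.+4]add4n ltn_add2l.
Qed.

(* The machine accepts iff the last test executed fails. *)
Definition machine : TM :=
  @MkTM #|state| #|cell| (encq None) (encq (Some (inl false))) (encq (Some (inl true)))
    (fun q x => let: (q', c, mv) := delta (decq q) (decc x) in (encq q', encc c, mv)).

Lemma machine_step q l x r :
  (forall b, q <> Some (inl b)) ->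
  @tm_step machine (encq q, l, x, r) =
  let: (q', c, mv) := delta q (decc x) in
  let y := encc c in
  match mv with
  | MStay => (encq q', l, y, r)
  | MLeft => if l is z :: l' then (encq q', l', z, y :: r)
             else (encq q', [::], tm_blank machine, y :: r)
  | MRight => if r is z :: r' then (encq q', y :: l, z, r')
              else (encq q', y :: l, tm_blank machine, [::])
  end.
Proof.
move=> hq; rewrite /tm_step /=.
rewrite !(can_eq encqK) (introF eqP (hq false)) (introF eqP (hq true)) /= encqK.
by case: (delta q (decc x)) => [[q' c] []].
Qed.

(** * One operation is one sweep *)

Section Simulation.

Variable w : seq 'I_3.
Local Notation N := (size w).

Definition cell_at s (j : nat) : cell :=
  (inord (inp w j), N <= j, j == 0, [ffun i => rg s i == j], (cur s j, nxt s j)).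

(** [L] is the number of cells visited so far. Nothing is marked from [L] on, so the blank met
    there, once visited, already is the right cell. *)
Definition within L s : Prop :=
  [/\ 0 < N, N <= L, forall i, rg s i < L & forall j, L <= j -> ~~ cur s j /\ ~~ nxt s j].

Lemma within_exec L o s : within L s -> within L.+1 (exec_op o s).
Proof.
case=> h0 h1 h2 h3; split=> //; first by rewrite leqW.
  move=> i; have h2' j : rg s j < L.+1 by rewrite leqW.
  by case: o => *; rewrite /= ?h2' //; case: ifP => _; rewrite ltnS ?h2 // ltnW.
move=> j jL; have [c1 c2] := h3 _ (ltnW jL).
case: o => //= i; split=> //; rewrite (negPf c2) orbF neq_ltn.
by rewrite (ltn_trans (h2 i) jL) orbT.
Qed.

Lemma inp_lt j : inp w j < 4.
Proof.
rewrite /inp; case: (ltnP j N) => h; last by rewrite nth_default ?size_map.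
by rewrite (nth_map c0) // ltnS ltn_ord.
Qed.

Lemma inp_gt0 j : j < N -> 0 < inp w j.
Proof. by move=> h; rewrite /inp (nth_map c0). Qed.

(** Closed form of the bit of the transducer on arrival at cell [j]: for [Inc], whether the mark to
    be moved was on the previous cell; for a test, whether a success has been seen. *)
Definition sweep_bit o s (j : nat) : bool :=
  match o with
  | Inc i => (rg s i).+1 == j
  | Eq i k => (rg s i < j) && (rg s i == rg s k)
  | Sym a i => (rg s i < j) && (inp w (rg s i) == a)
  | Get i => (rg s i < j) && cur s (rg s i)
  | _ => false
  end.

Lemma sweepE o s j :
  sweep o (sweep_bit o s j) (cell_at s j) = (sweep_bit o s j.+1, cell_at (exec_op o s) j).
Proof.
have split_lt n : (n < j.+1) = (n < j) || (n == j) by rewrite ltnS leq_eqVlt orbC.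
case: o => [i|i|i k|i k|a i|i|i|]; rewrite /sweep /cell_at /= ?ffunE //.
- congr (_, (_, _, _, _, _)); apply/ffunP => h; rewrite !ffunE.
  by case: ifP.
- congr (_, (_, _, _, _, _)); apply/ffunP => h; rewrite !ffunE.
  by case: ifP => //; rewrite eq_sym.
- congr (_, (_, _, _, _, _)); apply/ffunP => h; rewrite !ffunE.
  by case: ifP.
- by congr (_, _); rewrite split_lt; case: (ltnP (rg s i) j) => //= _; lia.
- congr (_, _); rewrite split_lt inordK ?inp_lt //.
  case: (ltnP (rg s i) j) => //= h; last by case: eqP => //= ->.
  by rewrite (ltn_eqF h) /= orbF.
- congr (_, _); rewrite split_lt.
  case: (ltnP (rg s i) j) => //= h; last by case: eqP => //= ->.
  by rewrite (ltn_eqF h) /= orbF.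
- by rewrite (eq_sym j (rg s i)).
Qed.

Lemma sweep_test L o s : within L s -> is_test o && sweep_bit o s L.+1 = test w o s.
Proof. by case=> _ _ h _; case: o => //= [i k|a i|i]; rewrite ltnS (ltnW (h i)). Qed.

Lemma cend_at s j : cend (cell_at s j) = false.
Proof.
rewrite /cend /= leqNgt negbK; case: ltnP => h; last by rewrite andbF.
by rewrite andbT -val_eqE /= inordK ?inp_lt // gtn_eqF // inp_gt0.
Qed.

Lemma visit_blank L s : within L s -> visit (decc (tm_blank machine)) = cell_at s L.
Proof.
case=> h0 h1 h2 h3; rewrite /decc /= /cell_at h1 gtn_eqF ?(leq_trans h0) //.
have [/negPf -> /negPf ->] := h3 L (leqnn _).
rewrite /inp nth_default ?size_map //.
by congr (_, _, _, _, _); apply/ffunP => i; rewrite !ffunE ltn_eqF.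
Qed.

Lemma sweep_right (lb : label p) s r x l j :
  map decc (x :: r) = map (cell_at s) (iota j (size r).+1) ->
  exists l', [/\ map decc l' = rev (map (cell_at (exec_op (op_at lb) s)) (iota j (size r).+1)) &
    @tm_run machine (size r).+1
      (encq (Some (inr (lb, true, sweep_bit (op_at lb) s j))), l, x, r)
    = (encq (Some (inr (lb, true, sweep_bit (op_at lb) s (j + (size r).+1)))),
       l' ++ l, tm_blank machine, [::])].
Proof.
elim: r => [|y r IH] in x l j * => e.
  move: e => [e]; exists [:: encc (cell_at (exec_op (op_at lb) s) j)]; split.
    by rewrite /= enccK.
  by rewrite tm_runS machine_step // [delta _ _]/= e cend_at sweepE addn1.
have [ex er] : decc x = cell_at s j /\
    map decc (y :: r) = map (cell_at s) (iota j.+1 (size r).+1).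
  by case: e => *; split=> //=; congr (_ :: _).
have [l' [h1 h2]] := IH y (encc (cell_at (exec_op (op_at lb) s) j) :: l) _ er.
exists (rcons l' (encc (cell_at (exec_op (op_at lb) s) j))); split.
  by rewrite map_rcons h1 enccK [iota j _]/= map_cons rev_cons.
rewrite tm_runS machine_step // [delta _ _]/= ex cend_at sweepE cat_rcons -addSnnS.
exact: h2.
Qed.

Lemma sweep_left (lb : label p) b s l x r j :
  map decc (x :: l) = rev (map (cell_at s) (iota 0 j.+1)) ->
  exists x' r', [/\ map decc (x' :: r') = map (cell_at s) (iota 0 j.+1) ++ map decc r &
    @tm_run machine j (encq (Some (inr (lb, false, b))), l, x, r)
    = (encq (Some (inr (lb, false, b))), [::], x', r')].
Proof.
elim: j => [|j IH] in x l r *.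
  by move=> [ex el]; exists x, r; rewrite /= ex; case: l el.
have -> : iota 0 j.+2 = rcons (iota 0 j.+1) j.+1 by rewrite -cats1 -(iotaD 0 j.+1 1) addn1.
rewrite map_rcons rev_rcons => -[ex el].
case: l el => [/(congr1 size)|y l el]; first by rewrite size_rev size_map.
have [x' [r' [h1 h2]]] := IH y l (encc (cell_at s j.+1) :: r) el.
exists x', r'; split; first by rewrite h1 /= enccK cat_rcons.
by rewrite tm_runS machine_step // /delta ex; exact: h2.
Qed.

Lemma machine_op (lb : label p) s L x r :
  map decc (x :: r) = map (cell_at s) (iota 0 L) -> within L s ->
  let b := test w (op_at lb) s in
  exists x' r', map decc (x' :: r') = map (cell_at (exec_op (op_at lb) s)) (iota 0 L.+1) /\
    @tm_run machine L.*2.+1 (encq (Some (inr (lb, true, false))), [::], x, r)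
    = (encq (Some (if next lb b is Some l' then inr (l', true, false) else inl b)),
       [::], x', r').
Proof.
move=> e ws b; set s' := exec_op (op_at lb) s.
have eL : (size r).+1 = L.
  by rewrite -[L](size_iota 0) -(size_map (cell_at s)) -e /= size_map.
rewrite -{1}eL in e.
have [l [hl run1]] := @sweep_right lb s r x [::] 0 e.
have b0 : sweep_bit (op_at lb) s 0 = false by case: (op_at lb) => //= *; rewrite ltn0.
rewrite b0 cats0 eL add0n in run1.
rewrite eL in hl.
case: l hl run1 => [/(congr1 size)|y l hl run1].
  by rewrite size_rev !size_map size_iota -eL.
have step : @tm_step machine (encq (Some (inr (lb, true, sweep_bit (op_at lb) s L))),
    y :: l, tm_blank machine, [::])
    = (encq (Some (inr (lb, false, b))), l, y, [:: encc (cell_at s' L)]).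
  rewrite machine_step // /delta.
  have -> : cend (decc (tm_blank machine)) by rewrite /cend /decc /= -val_eqE /= inordK.
  by rewrite (visit_blank ws) sweepE sweep_test.
rewrite -eL in hl; have [x' [r' [hr run2]]] := sweep_left lb b [:: encc (cell_at s' L)] hl.
exists (encc (decc x')), r'; split.
  by rewrite map_cons enccK -map_cons hr [map decc [:: _]]/= enccK -[L.+1]addn1 iotaD map_cat -eL.
(* [L] steps to the right, the turn at the new cell, [L - 1] steps back, and one step on the first
   cell to the next label. *)
have -> : L.*2.+1 = L + (size r).+2 by rewrite -addnn addnS eL.
rewrite tm_runD run1 tm_runS step -addn1 tm_runD run2 tm_runS.
have f0 : cfirst (decc x') by case: hr => ->.
by rewrite machine_step // /delta f0.
Qed.

(** The tape gains one cell per operation, so none of the [n] sweeps meets more than [L + n]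
    cells. *)
Lemma machine_flow (lb : label p) s n s' b : flow w lb s n s' b -> forall L x r,
  map decc (x :: r) = map (cell_at s) (iota 0 L) -> within L s ->
  exists t c, t <= n * (L + n).*2.+1 /\
    @tm_run machine t (encq (Some (inr (lb, true, false))), [::], x, r) = c /\
    tm_state c = encq (Some (inl b)).
Proof.
elim=> {lb s n s' b} [lb s b eb nl|lb l' s n s' b b' eb nl _ IH] L x r e ws;
  have [x' [r' [e' run1]]] := machine_op lb e ws; rewrite eb nl in run1.
  by exists L.*2.+1; eexists; split; last (split; [exact: run1 | by []]); lia.
have [t [c [ht [run2 hc]]]] := IH L.+1 x' r' e' (within_exec _ ws).
exists (L.*2.+1 + t), c; rewrite tm_runD run1; split=> //.
by rewrite mulSn addSnnS in ht *; lia.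
Qed.

Lemma decc_in (a : 'I_3) : decc (tm_in machine a) = raw (inord a.+1).
Proof.
have a4 : a.+1 < #|cell|.+4 by apply: leq_trans (_ : 4 <= _) => //; rewrite ltnS.
by rewrite /decc /tm_in inordK // ltnS ltn_ord.
Qed.

Lemma tm_step_halted b (c : tm_config machine) :
  tm_state c = encq (Some (inl b)) -> tm_step c = c.
Proof.
case: c => [[[q l] x] r] /= ->.
by rewrite !(can_eq encqK); case: b; rewrite eqxx ?orbT.
Qed.

Lemma machine_halts n s b T :
  0 < N -> flow w (entry p) (store0 reg) n s b -> n * (N + n).*2.+1 < T ->
  tm_state (tm_run T (tm_init machine w)) = encq (Some (inl b)).
Proof.
move=> N0 fl hT.
have [x [r ew]] : exists x r, map (@tm_in machine) w = x :: r.
  by case: (w) N0 => // x r _; exists (tm_in machine x), (map (@tm_in machine) r).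
have ws : within N (store0 reg) by split.
have e : map decc (encc (setup (decc x)) :: r) = map (cell_at (store0 reg)) (iota 0 N).
  have er : map decc (x :: r) = [seq raw (inord (inp w j)) | j <- iota 0 N].
    rewrite -ew -map_comp; apply: (@eq_from_nth _ (raw ord0)) => [|j].
      by rewrite !size_map size_iota.
    rewrite size_map => hj; rewrite (nth_map c0) // /= decc_in (nth_map 0) ?size_iota //.
    by rewrite nth_iota // /inp (nth_map c0).
  move: er; case eN: {-2}N => [|m]; rewrite ?eN // in N0 *.
  move=> /= [-> ->]; rewrite enccK; congr (_ :: _).
    by rewrite /= /cell_at eN; congr (_, _, _, _, _); apply/ffunP => i; rewrite !ffunE.
  apply/eq_in_map => j; rewrite mem_iota => /andP [j0 hj].
  rewrite /raw /cell_at eN leqNgt [j < _]hj gtn_eqF //.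
  by congr (_, _, _, _, _); apply/ffunP => i; rewrite !ffunE ltn_eqF.
have [t [c [ht [run1 hc]]]] := machine_flow fl e ws.
have step : tm_step (tm_init machine w)
    = (encq (Some (inr (entry p, true, false))), [::], encc (setup (decc x)), r).
  by rewrite /tm_init ew; apply: (@machine_step None).
(* The extra step is the one for [setup]; after [t.+1] steps the machine has halted and its
   configuration is stable. *)
have -> : T = t.+1 + (T - t.+1) by lia.
rewrite tm_runD tm_runS step run1.
have halted : tm_step c = c by apply: tm_step_halted hc.
by elim: (T - t.+1) => // k IH; rewrite tm_runS halted.
Qed.

End Simulation.

End Compile.

End Machine.

(** * Short witnesses *)

Lemma cat_nseq_split (T : Type) (u v x y : seq T) (a : T) n :
  u ++ nseq n a ++ v = x ++ y ->
  [\/ exists z, u = x ++ z /\ y = z ++ nseq n a ++ v,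
      exists m m', [/\ n = m + m', x = u ++ nseq m a & y = nseq m' a ++ v]
    | exists z, x = u ++ nseq n a ++ z /\ v = z ++ y].
Proof.
elim: u x => [|b u IH] [|c x] /=.
- by move=> <-; apply: Or31; exists [::].
- elim: n c x => [|n IHn] c x /=; first by move=> ->; apply: Or33; exists (c :: x).
  case=> <-; case: x => [|d x] /=.
    by move=> <-; apply: Or32; exists 1, n.
  case/IHn => [[z []] //|[m [m' [-> -> ->]]]|[z [-> ->]]].
    by apply: Or32; exists m.+1, m'.
  by apply: Or33; exists z.
- by move=> <-; apply: Or31; exists (b :: u).
case=> <- /IH [[z [-> ->]]|[m [m' [-> -> ->]]]|[z [-> ->]]].
- by apply: Or31; exists z.
- by apply: Or32; exists m, m'.
- by apply: Or33; exists z.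
Qed.

(** Induction on the star-free expression. Complements are covered because the claim is symmetric in
    [n] and [n']; for a concatenation the thresholds add up. *)
Lemma star_free_aperiodic k (L : lang k) : star_free L ->
  exists n0, forall n n' u v (a : 'I_k), n0 <= n -> n0 <= n' ->
    L (u ++ nseq n a ++ v) -> L (u ++ nseq n' a ++ v).
Proof.
elim=> {L} [s|L1 L2 _ [n1 h1] _ [n2 h2]|L1 L2 _ [n1 h1] _ [n2 h2]|L _ [n0 h]|L1 L2 _ [n0 h] e].
- exists (\max_(x <- s) size x).+1 => n n' u v a hn _ /= us.
  suff: size (u ++ nseq n a ++ v) <= \max_(x <- s) size x.
    by rewrite !size_cat size_nseq; lia.
  by rewrite (big_rem _ us) /= leq_maxl.
- exists (maxn n1 n2) => n n' u v a; rewrite !geq_max => /andP [a1 a2] /andP [b1 b2].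
  by case=> [/h1|/h2] H; [left|right]; apply: H.
- exists (n1 + n2) => n n' u v a hn hn' [x [y [exy [Lx Ly]]]].
  case: (cat_nseq_split exy) Lx Ly => [[z [-> ->]]|[m [m' [en -> ->]]]|[z [-> ->]]] Lx Ly.
  + exists x, (z ++ nseq n' a ++ v); rewrite -catA; do 2?split=> //.
    by apply: h2 Ly; lia.
  (* The cut falls inside the block. Since [n1 + n2 <= n], at most one of the two parts is below its
     threshold; that part is kept and the other absorbs the change of length. *)
  + have [i [j [eij hi hj]]] : exists i j, [/\ n' = i + j, i = m \/ n1 <= m /\ n1 <= i &
        j = m' \/ n2 <= m' /\ n2 <= j].
      case: (leqP n1 m) => hm; last by exists m, (n' - m); split; [lia|left|right; lia].
      case: (leqP n2 m') => hm'; first by exists n1, (n' - n1); split; [lia|right|right; lia].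
      by exists (n' - m'), m'; split; [lia|right; lia|left].
    exists (u ++ nseq i a), (nseq j a ++ v); split; first by rewrite eij nseqD -!catA.
    split.
      by case: hi => [->|[b c]] //; rewrite -[nseq i a]cats0; apply: h1 b c _; rewrite cats0.
    by case: hj => [->|[b c]] //; apply: (h2 _ _ [::]) b c Ly.
  + exists (u ++ nseq n' a ++ z), y; rewrite -!catA; do 2?split=> //.
    by apply: h1 Lx; lia.
- by exists n0 => n n' u v a hn hn' nL /(h _ _ _ _ _ hn' hn).
- by exists n0 => n n' u v a hn hn' /e /(h _ _ _ _ _ hn hn') /e.
Qed.

Lemma commutative_perm k (L : lang k) : commutative_lang L ->
  forall u v, perm_eq u v -> L u -> L v.
Proof.
move=> cL.
have shift u x v a : L (u ++ a :: x ++ v) -> L (u ++ x ++ a :: v).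
  by elim: x u => //= b x IH u /cL; rewrite -cat_rcons => /IH; rewrite cat_rcons.
have block u x y v : L (u ++ x ++ y ++ v) -> L (u ++ y ++ x ++ v).
  elim: x u => //= a x IH u; rewrite -cat_rcons => /IH; rewrite cat_rcons; exact: shift.
by apply: catCA_perm_ind => x y z; apply: (block [::]).
Qed.

(** * Lengths of walks in a finite graph *)

Section Walks.

Variables (T : finType) (D : nat -> rel T).
Hypothesis D0 : forall q p, D 0 q p = (q == p).
Hypothesis Dadd : forall m n q p, reflect (exists2 r, D m q r & D n r p) (D (m + n) q p).

Lemma walk e q p : D e q p ->
  exists f : nat -> T, forall i j, i <= j <= e -> D (j - i) (f i) (f j) /\ f 0 = q /\ f e = p.
Proof.
elim: e p => [|e IH] p; first rewrite D0 => /eqP <-.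
  exists (fun _ => q) => i j /andP [ij]; rewrite leqn0 => /eqP j0; subst j.
  by rewrite leqn0 in ij; rewrite sub0n D0 eqxx.
rewrite -addn1 => /Dadd [r /IH [f hf] rp].
exists (fun i => if i <= e then f i else p) => i j; rewrite addn1 ltnn /= => /andP [ij je].
have [_ [f0 fe]] := hf 0 0 isT.
split=> //; case: (leqP j e) => h; first by rewrite (leq_trans ij h); apply: (hf i j _).1; rewrite ij.
have -> : j = e.+1 by apply/eqP; rewrite eqn_leq je.
case: (leqP i e) => h'; last first.
  have -> : i = e.+1 by apply/eqP; rewrite eqn_leq h' (leq_trans ij je).
  by rewrite subnn D0.
rewrite subSn // -addn1; apply/Dadd; exists r => //.
by rewrite -fe; apply: (hf i e _).1; rewrite h' leqnn.
Qed.

(** Pigeonhole on pairs of a vertex and a position modulo [c]: the segment between two equal pairs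
    can be cut out, and its length is a multiple of [c]. *)
Lemma walk_shrink c e q p : 0 < c -> D e q p ->
  exists2 e', D e' q p & e' < #|T| * c /\ e' = e %[mod c].
Proof.
move=> c0; elim/ltn_ind: e => e IH De.
case: (ltnP e (#|T| * c)) => h; first by exists e.
have [f hf] := walk De.
pose g (i : 'I_e.+1) : T * 'I_c := (f i, Ordinal (ltn_pmod i c0)).
have : ~~ injectiveb g.
  apply/negP => /injectiveP /leq_card; rewrite card_prod !card_ord leqNgt.
  by rewrite ltnS h.
case/injectivePn => x [y xy gxy].
wlog lxy : x y xy gxy / x < y.
  move=> H; case: (ltngtP x y) => hxy; [exact: H gxy hxy|apply: H (esym gxy) hxy; by rewrite eq_sym|].
  by case/eqP: xy; apply: val_inj.
case: gxy => fxy /eqP mxy.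
have ye : y <= e by rewrite -ltnS.
have [d1 [f0 fe]] := hf 0 x (leq_trans (ltnW lxy) ye).
have [|d2 _] := hf y e; first by rewrite ye leqnn.
rewrite subn0 f0 in d1; rewrite fe -fxy in d2.
have d3 : D (x + (e - y)) q p by apply/Dadd; exists (f x).
have [|e' De' [h1 h2]] := IH _ _ d3; first by lia.
exists e' => //; split=> //; rewrite h2 -[in RHS](subnKC ye).
by apply/eqP; rewrite eqn_modDr.
Qed.

Lemma walk_cycle e q p : #|T| <= e -> D e q p ->
  exists c r i, [/\ 0 < c <= #|T|, i <= e, D i q r, D (e - i) r p & D c r r].
Proof.
move=> h De; have [f hf] := walk De.
pose g (i : 'I_#|T|.+1) : T := f i.
have : ~~ injectiveb g.
  by apply/negP => /injectiveP /leq_card; rewrite card_ord ltnn.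
case/injectivePn => x [y xy gxy].
wlog lxy : x y xy gxy / x < y.
  move=> H; case: (ltngtP x y) => hxy; [exact: H gxy hxy|apply: H (esym gxy) hxy; by rewrite eq_sym|].
  by case/eqP: xy; apply: val_inj.
have yT : y <= #|T| by rewrite -ltnS.
have ye := leq_trans yT h; have xe := leq_trans (ltnW lxy) ye.
have [d1 [f0 fe]] := hf 0 x xe.
have [|d2 _] := hf x e; first by rewrite xe leqnn.
have [|d3 _] := hf x y; first by rewrite ye ltnW.
rewrite subn0 f0 in d1; rewrite fe in d2; rewrite -[f y]gxy in d3.
by exists (y - x), (f x), x; split=> //; lia.
Qed.

(** The walk passes through some [r] on a cycle of length [c <= #|T|]. Modulo [c], the parts before
    and after [r] shrink below [#|T| * c <= #|T| ^ 2] each. What is missing to [e'] is a multiple of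
    [c], because [c] divides [#|T|!], and is filled by repeating the cycle. *)
Lemma walk_period e e' q p : 2 * #|T| ^ 2 <= e -> 2 * #|T| ^ 2 <= e' ->
  e = e' %[mod #|T|`!] -> D e q p -> D e' q p.
Proof.
move=> he he' ee De.
have T0 : 0 < #|T| by apply/card_gt0P; exists q.
have [|c [r [i [/andP [c0 cT] ie d1 d2 d3]]]] := walk_cycle _ De; first by nia.
have [i' di [hi mi]] := walk_shrink c0 d1.
have [j' dj [hj mj]] := walk_shrink c0 d2.
have hij : i' + j' <= e'.
  have Tc : #|T| * c <= #|T| ^ 2 by rewrite expnS expn1 leq_mul2l cT orbT.
  apply: leq_trans he'; rewrite mul2n -addnn.
  by apply: leq_add; apply: leq_trans Tc; apply: ltnW.
have eqc : i' + j' = e' %[mod c].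
  have cf : c %| #|T|`! by rewrite dvdn_fact ?c0.
  rewrite -modnDm mi mj modnDm subnKC // -(modn_dvdm e cf) -(modn_dvdm e' cf).
  by rewrite ee.
have dm m : D (m * c) r r.
  by elim: m => [|m IH]; rewrite ?mul0n ?D0 // mulSn; apply/Dadd; exists r.
have : c %| e' - (i' + j') by rewrite -eqn_mod_dvd //; apply/eqP.
case/dvdnP => m em.
have -> : e' = i' + (m * c + j') by rewrite -em [_ + j']addnC addnA subnKC.
by apply/Dadd; exists r => //; apply/Dadd; exists r.
Qed.

End Walks.

(** * Powers of a letter in a totally star-free automaton *)

Section Automata.

Variables (k : nat) (A : nfa k).
Local Notation state := 'I_(nfa_n A).+1.
Implicit Types (S : {set state}) (q p : state) (u v w : seq 'I_k) (a : 'I_k).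

Lemma nfa_reach_cat S u v : nfa_reach S (u ++ v) = nfa_reach (nfa_reach S u) v.
Proof. by elim: u S => //= a u IH S. Qed.

Lemma nfa_reachP S w p :
  reflect (exists2 q, q \in S & p \in nfa_reach [set q] w) (p \in nfa_reach S w).
Proof.
elim: w S p => [|a w IH] S p /=.
  by apply: (iffP idP) => [h|[q qS]]; [exists p; rewrite ?inE | rewrite inE => /eqP ->].
apply: (iffP (IH _ _)) => [[q /bigcupP [r rS rq] h]|[q qS /IH [r]]].
  exists r => //; apply/IH; exists q => //; apply/bigcupP; exists r => //.
  by rewrite inE.
case/bigcupP => s; rewrite inE => /eqP -> qr h; exists r => //.
by apply/bigcupP; exists q.
Qed.

Lemma nfa_lang_set1 q p w : nfa_lang_from q [set p] w <-> p \in nfa_reach [set q] w.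
Proof.
split=> [/existsP [r /andP [h]]|h]; first by rewrite inE => /eqP <-.
by apply/existsP; exists p; rewrite h inE eqxx.
Qed.

Definition cap (B e : nat) : nat := if e < B then e else B.-1.

Lemma cap_lt B e : 0 < B -> cap B e < B.
Proof. by rewrite /cap; case: ifP => // _; case: B. Qed.

Hypothesis tsf : totally_star_free A.

(** A detour through large exponents: adding the multiple [t] of the factorial lifts both exponents
    above the threshold [n0] without changing residues, aperiodicity passes from [f + t] to
    [f' + t], and periodicity descends again. *)
Lemma nfa_reach_nseq e e' q a : 2 * (nfa_n A).+1 ^ 2 <= e -> 2 * (nfa_n A).+1 ^ 2 <= e' ->
  nfa_reach [set q] (nseq e a) = nfa_reach [set q] (nseq e' a).
Proof.
pose D e := [rel q p : state | p \in nfa_reach [set q] (nseq e a)].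
have D0 x y : D 0 x y = (x == y) by rewrite /= inE eq_sym.
have Dadd m n x y : reflect (exists2 r, D m x r & D n r y) (D (m + n) x y).
  by rewrite /= nseqD nfa_reach_cat; apply: nfa_reachP.
suff sub f f' p : 2 * (nfa_n A).+1 ^ 2 <= f -> 2 * (nfa_n A).+1 ^ 2 <= f' ->
    D f q p -> D f' q p.
  by move=> he he'; apply/setP => p; apply/idP/idP; apply: sub.
move=> hf hf' Df; have [n0 ap] := star_free_aperiodic (tsf q p).
set t := n0 * (#|{: state}|`!).
have tn : n0 <= t by rewrite leq_pmulr ?fact_gt0.
have period g g' := @walk_period _ D D0 Dadd g g' q p.
rewrite card_ord in period.
have h1 : D (f + t) q p.
  apply: period Df => //; first exact: leq_trans (leq_addr _ _).
  by rewrite /t card_ord addnC modnMDl.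
have h2 : D (f' + t) q p.
  apply/nfa_lang_set1; rewrite -[nseq _ a]cats0 -[_ ++ _]cat0s.
  apply: (ap (f + t)); try by apply: leq_trans tn _; rewrite leq_addl.
  by rewrite cats0; apply/nfa_lang_set1.
apply: period h2 => //; first exact: leq_trans (leq_addr _ _).
by rewrite /t card_ord addnC modnMDl.
Qed.

Lemma nfa_reach_cap B e S a : 2 * (nfa_n A).+1 ^ 2 < B ->
  nfa_reach S (nseq (cap B e) a) = nfa_reach S (nseq e a).
Proof.
move=> hB; rewrite /cap; case: ltnP => // he.
apply/setP => p; apply/nfa_reachP/nfa_reachP => -[q qS h]; exists q => //.
  by rewrite (nfa_reach_nseq (e' := B.-1)) //; lia.
by rewrite (nfa_reach_nseq (e' := e)) //; lia.
Qed.

End Automata.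

(** * Sorted words and their numbering *)

Definition letter_word k (e : 'I_k -> nat) : seq 'I_k := flatten [seq nseq (e a) a | a <- enum 'I_k].

Lemma perm_letter_word k (w : seq 'I_k) : perm_eq w (letter_word (fun a => count_mem a w)).
Proof.
apply/allP => a _; rewrite /letter_word /= count_flatten -map_comp sumnE big_map big_enum /=.
rewrite (bigD1 a) //= count_nseq /= eqxx mul1n big1 ?addn0 // => b /negPf ne.
by rewrite count_nseq /= ne.
Qed.

(** Sorting collects each letter in one block, and capping a block preserves the set of states
    reached after it. *)
Lemma nfa_lang_cap k (A : nfa k) B w :
  totally_star_free A -> commutative_lang (nfa_lang A) -> 2 * (nfa_n A).+1 ^ 2 < B ->
  nfa_lang A w -> nfa_lang A (letter_word (fun a => cap B (count_mem a w))).
Proof.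
move=> tA cA hB /(commutative_perm cA (perm_letter_word w)).
rewrite /nfa_lang /nfa_lang_from /letter_word.
move: [set _] => S; suff -> : nfa_reach S (flatten [seq nseq (count_mem a w) a | a <- enum 'I_k])
  = nfa_reach S (flatten [seq nseq (cap B (count_mem a w)) a | a <- enum 'I_k]) by [].
elim: (enum _) S => //= a s IH S.
by rewrite !nfa_reach_cat IH nfa_reach_cap.
Qed.

Definition digit (B E a : nat) : nat := (E %/ B ^ a) %% B.

Lemma digitsP B m (e : nat -> nat) : (forall a, e a < B) ->
  exists2 E, E < B ^ m & forall a, a < m -> digit B E a = e a.
Proof.
move=> he; elim: m e he => [|m IH] e he; first by exists 0.
have [E hE dE] := IH (fun a => e a.+1) (fun a => he _).
have B0 : 0 < B by apply: leq_ltn_trans (he 0).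
exists (E * B + e 0).
  by rewrite expnS; have := he 0; nia.
case=> [|a] ha; rewrite /digit.
  by rewrite expn0 divn1 modnMDl modn_small.
by rewrite expnS divnMA divnMDl // (divn_small (he 0)) addn0; apply: dE.
Qed.

Definition digit_word k B E : seq 'I_k := letter_word (fun a : 'I_k => digit B E a).

Lemma bounded_witness k (As : seq (nfa k)) B :
  (forall A, List.In A As ->
    [/\ totally_star_free A, commutative_lang (nfa_lang A) & 2 * (nfa_n A).+1 ^ 2 < B]) ->
  0 < B ->
  (exists w, forall A, List.In A As -> nfa_lang A w) ->
  exists2 E, E < B ^ k & forall A, List.In A As -> nfa_lang A (digit_word k B E).
Proof.
move=> hAs B0 [w hw].
(* [digitsP] takes a function on all naturals; outside the alphabet the value is 0. *)
pose e a := if insub a is Some a' then cap B (count_mem (a' : 'I_k) w) else 0.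
have [|E hE dE] := @digitsP B k e.
  by move=> a; rewrite /e; case: insubP => // *; apply: cap_lt.
exists E => // A hA; have [tA cA BA] := hAs A hA.
have -> : digit_word k B E = letter_word (fun a => cap B (count_mem a w)).
  by congr flatten; apply/eq_map => a; rewrite dE // /e valK.
exact: nfa_lang_cap tA cA BA (hw A hA).
Qed.

(** * The search program *)

(* [rZ] is never written and stays 0. *)
Variant reg :=
| rZ | rK | rLen | rB | rBK | rT | rI | rJ | rP | rQ | rA | rL
| rE | rFound | rBad | rD | rN | rF | rD0 | rCur | rEx | rQt | rOk.

Definition reg_list : seq reg :=
  [:: rZ; rK; rLen; rB; rBK; rT; rI; rJ; rP; rQ; rA; rL;
      rE; rFound; rBad; rD; rN; rF; rD0; rCur; rEx; rQt; rOk].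

Definition reg_code (r : reg) : nat :=
  match r with
  | rZ => 0 | rK => 1 | rLen => 2 | rB => 3 | rBK => 4 | rT => 5 | rI => 6 | rJ => 7
  | rP => 8 | rQ => 9 | rA => 10 | rL => 11 | rE => 12 | rFound => 13 | rBad => 14
  | rD => 15 | rN => 16 | rF => 17 | rD0 => 18 | rCur => 19 | rEx => 20 | rQt => 21
  | rOk => 22
  end.

Lemma reg_codeK : cancel reg_code (nth rZ reg_list). Proof. by case. Qed.
HB.instance Definition _ := Countable.copy reg (can_type reg_codeK).
Lemma reg_enumP : Finite.axiom reg_list. Proof. by case. Qed.
HB.instance Definition _ := isFinite.Build reg reg_enumP.

Declare Scope prog_scope.
Local Notation "p ;; q" := (Seq p q) (at level 60, right associativity) : prog_scope.
Local Open Scope prog_scope.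

Local Notation run := (@Do reg) (only parsing).
Local Notation skip := (Do (Eq rZ rZ)).

(* The symbols 2 and 3 are the input letters 1 and #, and 0 is the blank. *)
Definition setup_prog : prog reg :=
  While true (Sym 2 rK) (run (Inc rK)) ;;
  While false (Sym 0 rLen) (run (Inc rLen)) ;;
  run (Inc rB) ;;
  (* Arithmetic by counting: [rB] becomes [2 * N ^ 2 + 1] here, and the last loop multiplies [rBK]
     by it [k] times. *)
  For rI rLen (For rJ rLen (run (Inc rB) ;; run (Inc rB))) ;;
  run (Inc rBK) ;;
  For rI rK (run (Zero rT) ;; For rJ rBK (For rP rB (run (Inc rT))) ;; run (Mov rBK rT)).

(** The whole transition table is traversed for every letter read, so that the pointer [rD] only
    ever advances by one and no address has to be computed. *)
Definition step_prog : prog reg :=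
  run (Mov rD rD0) ;;
  For rQ rN (For rL rK (For rP rN (
    If (Eq rL rA) (If (Get rQ) (If (Sym 2 rD) (run (Put rP)) skip) skip) skip ;;
    run (Inc rD)))) ;;
  run (@Flush reg).

(** Division by counting to [rCur]: [rEx] runs through the remainders and each wrap-around
    increments [rQt]. *)
Definition divide_prog : prog reg :=
  run (Zero rEx) ;; run (Zero rQt) ;;
  For rI rCur (run (Inc rEx) ;; If (Eq rEx rB) (run (Zero rEx) ;; run (Inc rQt)) skip) ;;
  run (Mov rCur rQt).

Definition word_prog : prog reg :=
  run (Mov rCur rE) ;;
  For rA rK (divide_prog ;; For rJ rEx step_prog).

Definition final_prog : prog reg :=
  run (Zero rOk) ;;
  For rP rN (If (Sym 2 rF) (If (Get rP) (run (Inc rOk)) skip) skip ;; run (Inc rF)) ;;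
  If (Eq rOk rZ) (run (Inc rBad)) skip.

Definition count_prog (i : reg) : prog reg :=
  run (Zero i) ;; While true (Sym 2 rD) (run (Inc i) ;; run (Inc rD)) ;; run (Inc rD).

Definition jump_prog : prog reg := While false (Sym 3 rD) (run (Inc rD)) ;; run (Inc rD).

Definition nfa_prog : prog reg :=
  count_prog rN ;; count_prog rQ ;;
  (* The first [Flush] empties [nxt]; the second makes the singleton of the initial state current
     and empties [nxt] again. *)
  run (@Flush reg) ;; run (Put rQ) ;; run (@Flush reg) ;;
  run (Mov rF rD) ;; jump_prog ;; run (Mov rD0 rD) ;;
  word_prog ;;
  run (Mov rD rD0) ;; jump_prog ;;
  final_prog.

Definition check_prog : prog reg :=
  run (Zero rBad) ;; run (Mov rD rK) ;; run (Inc rD) ;; While false (Sym 0 rD) nfa_prog.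

Definition search_prog : prog reg :=
  setup_prog ;; For rE rBK (check_prog ;; If (Eq rBad rZ) (run (Inc rFound)) skip).

Lemma ltn_succ m n : (m < n.+1) = (m == n) || (m < n).
Proof. by rewrite ltnS leq_eqVlt. Qed.

(** * Correctness of the programs for one automaton *)

Section Programs.

Variables (w : seq 'I_3) (X : nat).
Local Notation wp := (@wp reg w X).
Local Notation inp := (inp w).

Lemma count_prog_wp (i : reg) s d m : i = rN \/ i = rQ -> m <= X -> rg s rD = d ->
  (forall j, j < m -> inp (d + j) = 2) -> inp (d + m) != 2 ->
  wp (count_prog i) s (fun s' => rg s' i = m /\ rg s' rD = d + m.+1).
Proof.
move=> hi mX sd h1 h2; apply: wp_seq; apply: wp_do.
apply: (@wp_cat _ _ _ _ _ _ (fun s' => rg s' i = m /\ rg s' rD = d + m)).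
  apply: (wp_while (I := fun v s' => rg s' i = v /\ rg s' rD = d + v)) mX _ _ _.
  - by case: hi => -> /=; rewrite addn0.
  - move=> v s' vm [si sD] _; split; first by rewrite /= sD h1.
    apply: wp_seq; apply: wp_do; apply: wp_do.
    by case: hi si => -> /= ->; rewrite sD addnS.
  - by move=> s' [si sD] _; rewrite /= sD; apply: negPf.
by move=> s' _ [si sD]; apply: wp_do; case: hi si => -> /= ->; rewrite sD addnS.
Qed.

Lemma jump_prog_wp s d m : m <= X -> rg s rD = d ->
  (forall j, j < m -> inp (d + j) != 3) -> inp (d + m) = 3 ->
  wp jump_prog s (fun s' => rg s' rD = d + m.+1).
Proof.
move=> mX sd h1 h2.
apply: (@wp_cat _ _ _ _ _ _ (fun s' => rg s' rD = d + m)).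
  apply: (wp_while (I := fun v s' => rg s' rD = d + v)) mX _ _ _.
  - by rewrite addn0.
  - move=> v s' vm sD _; split; first by rewrite /= sD (negPf (h1 _ vm)).
    by apply: wp_do; rewrite /= sD addnS.
  - by move=> s' sD _; rewrite /= sD h2.
by move=> s' _ sD; apply: wp_do; rewrite /= sD addnS.
Qed.

Lemma divide_prog_wp s E B : 0 < B -> E <= X -> rg s rCur = E -> rg s rB = B ->
  wp divide_prog s (fun s' => rg s' rEx = E %% B /\ rg s' rCur = E %/ B).
Proof.
move=> B0 EX sE sB; do 2!(apply: wp_seq; apply: wp_do).
apply: (@wp_cat _ _ _ _ _ _ (fun s' => rg s' rEx = E %% B /\ rg s' rQt = E %/ B)).
  apply: (wp_for (I := fun v s' => rg s' rEx = v %% B /\ rg s' rQt = v %/ B)) => //=.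
    by rewrite mod0n div0n.
  move=> v s' vE [h1 h2] _ [fr _ _].
  have hB : rg s' rB = B by rewrite (fr rB isT).
  have hm : v.+1 %% B = (v %% B).+1 %% B by rewrite -addn1 -modnDml addn1.
  have hd : v.+1 %/ B = v %/ B + (v %% B).+1 %/ B.
    by rewrite {1}(divn_eq v B) -addnS divnMDl.
  have lt : (v %% B).+1 <= B by rewrite ltn_mod.
  apply: wp_seq; apply: wp_do; apply: wp_if => /=; rewrite h1 hB.
    move/eqP=> e; apply: wp_seq; apply: wp_do; apply: wp_do => /=.
    by rewrite hm hd e modnn divnn B0 addn1 h2.
  move=> e; apply: wp_do => /=; rewrite hm hd h2.
  have {}lt : (v %% B).+1 < B by rewrite ltn_neqAle e.
  by rewrite (modn_small lt) (divn_small lt) addn0.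
by move=> s' _ [h1 h2]; apply: wp_do.
Qed.

Section OneAutomaton.

(** The code of [A] starts at position [d] of the input, its row of final states at [f0] and its
    transition table at [d0]. The hypotheses on [inp] describe this layout and are discharged in
    [nfa_prog_spec]. *)
Variables (k : nat) (A : nfa k) (d f0 d0 B E : nat).
Local Notation n := (nfa_n A).+1.
Implicit Types S : {set 'I_n}.

Hypothesis nX : n <= X.
Hypothesis kX : k <= X.
Hypothesis delta_bits : forall (q p : nat) (a : nat) (hq : q < n) (ha : a < k) (hp : p < n),
  (inp (d0 + (q * k + a) * n + p) == 2) =
  (Ordinal hp \in nfa_delta (Ordinal hq) (Ordinal ha)).

Definition represents (f : nat -> bool) S := forall p : 'I_n, f p = (p \in S).

Lemma step_prog_wp s (a : 'I_k) S :
  rg s rD0 = d0 -> rg s rN = n -> rg s rK = k -> rg s rA = a ->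
  represents (cur s) S -> nxt s =1 xpred0 ->
  wp step_prog s (fun s' =>
    represents (cur s') (\bigcup_(q in S) nfa_delta q a) /\ nxt s' =1 xpred0).
Proof.
move=> sD0 sN sK sA sS s0; apply: wp_seq; apply: wp_do.
pose bit q p := inp (d0 + (q * k + a) * n + p) == 2.
(* The successors of the current states below [m]; the three nested invariants refine this set by
   row, letter and target. *)
pose new m p := has (fun q => cur s q && bit q p) (iota 0 m).
have newS m p : new m.+1 p = new m p || (cur s m && bit m p).
  by rewrite /new -[m.+1]addn1 iotaD has_cat /= orbF.
apply: (@wp_cat _ _ _ _ _ _ (fun s' => forall p, p < n -> nxt s' p = new n p)).
  apply: wp_mono; first apply: (wp_for (n := n) (I := fun q s' =>
    rg s' rD = d0 + q * k * n /\ forall p, p < n -> nxt s' p = new q p)) => //=.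
    by rewrite !mul0n addn0.
  move=> q s1 hq [s1D s1n] s1q [fr1 fc1 _].
  have s1cur : cur s1 = cur s by rewrite fc1.
  have [s1K s1N] : rg s1 rK = k /\ rg s1 rN = n by rewrite (fr1 rK isT) (fr1 rN isT).
  have s1A : rg s1 rA = a by rewrite (fr1 rA isT).
  (* The row of [q] has contributed once the part for the letter [a] has been passed, that is, when
     [a < l]. *)
  apply: wp_mono; first apply: (wp_for (n := k) (I := fun l s' =>
    rg s' rD = d0 + (q * k + l) * n /\
    forall p, p < n -> nxt s' p = new q p || [&& a < l, cur s q & bit q p])) => //=.
    by rewrite addn0; split=> // p hp; rewrite s1n // orbF.
  move=> l s2 hl [s2D s2n] s2l [fr2 fc2 _].
  have s2cur : cur s2 = cur s by rewrite fc2.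
  have s2N : rg s2 rN = n by rewrite (fr2 rN isT).
  have [s2A s2q] : rg s2 rA = a /\ rg s2 rQ = q by rewrite (fr2 rA isT) (fr2 rQ isT).
  apply: wp_mono; first apply: (wp_for (n := n) (I := fun m s' =>
    rg s' rD = d0 + (q * k + l) * n + m /\
    forall p, p < n -> nxt s' p = [|| new q p, [&& a < l, cur s q & bit q p]
      | [&& l == a, p < m, cur s q & bit q p]])) => //=.
    by rewrite addn0; split=> // p hp; rewrite s2n // ?ltn0 andbF orbF.
  move=> m s3 hm [s3D s3n] s3P [fr3 fc3 _].
  have s3cur : cur s3 = cur s by rewrite fc3.
  have [s3A s3q] : rg s3 rA = a /\ rg s3 rQ = q by rewrite (fr3 rA isT) (fr3 rQ isT).
  have s3l : rg s3 rL = l by rewrite (fr3 rL isT).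
  apply: (@wp_cat _ _ _ _ _ _ (fun s' => rg s' rD = d0 + (q * k + l) * n + m /\
    forall p, p < n -> nxt s' p = [|| new q p, [&& a < l, cur s q & bit q p]
      | [&& l == a, p < m.+1, cur s q & bit q p]])).
    have same : [&& l == a, cur s q & bit q m] = false -> forall p, p < n ->
      nxt s3 p = [|| new q p, [&& a < l, cur s q & bit q p]
        | [&& l == a, p < m.+1, cur s q & bit q p]].
      move=> e p hp; rewrite s3n // ltn_succ; case: (p =P m) => [->|] //=.
      by rewrite ltnn andbF /= e.
    apply: wp_if; rewrite /= s3l s3A => hl1; last first.
      by apply: wp_do; split=> //; apply: same; rewrite (negPf hl1).
    apply: wp_if; rewrite /= s3cur s3q => hc; last first.
      by apply: wp_do; split=> //; apply: same; rewrite (negPf hc) andbF.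
    apply: wp_if; rewrite /= s3D => hb; last first.
      apply: wp_do; split=> //; apply: same; rewrite /bit.
      by case: eqP => //= <-; rewrite (negPf hb) andbF.
    apply: wp_do; rewrite /= s3D s3P; split=> // p hp; rewrite s3n // ltn_succ.
    case: (p =P m) => [->|] //=.
    by rewrite hl1 hc /bit -(eqP hl1) hb !orbT.
  move=> s4 _ [s4D s4n]; apply: wp_do => /=; rewrite s4D; split; first by rewrite addnS.
  by move=> p hp; rewrite s4n.
  + move=> s3 _ [s3D s3n] /=; split; first by rewrite s3D; nia.
    move=> p hp; rewrite s3n // hp ltn_succ [_ == l]eq_sym; congr (_ || _).
    by case: (_ == _ :> nat); case: (a < l); case: (cur s q && bit q p).
  + move=> s2 _ [s2D s2n] /=; split; first by rewrite s2D; nia.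
    by move=> p hp; rewrite s2n // ltn_ord newS.
  + by move=> s1 _ [].
move=> s1 [fr1 fc1 _] s1n; apply: wp_do => /=; split=> // p.
rewrite s1n //; apply/hasP/bigcupP => [[q]|[q qS hp]].
  rewrite mem_iota add0n /= => hq /andP [cq bq]; exists (Ordinal hq).
    by rewrite -(sS (Ordinal hq)).
  move: bq; rewrite /bit (delta_bits hq (ltn_ord a) (ltn_ord p)).
  by congr (is_true (_ \in nfa_delta _ _)); apply: val_inj.
exists (val q); first by rewrite mem_iota add0n ltn_ord.
rewrite sS qS /bit (delta_bits (ltn_ord q) (ltn_ord a) (ltn_ord p)).
by move: hp; congr (is_true (_ \in nfa_delta _ _)); apply: val_inj.
Qed.

Lemma word_prog_wp s S :
  0 < B -> B <= X -> E <= X ->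
  rg s rE = E -> rg s rB = B -> rg s rD0 = d0 -> rg s rN = n -> rg s rK = k ->
  represents (cur s) S -> nxt s =1 xpred0 ->
  wp word_prog s (fun s' => represents (cur s') (nfa_reach S (digit_word k B E))).
Proof.
move=> B0 BX EX sE sB sD0 sN sK sS s0.
(* The blocks of the first [m] letters. After [m] divisions [rCur] is [E %/ B ^ m], so the next
   remainder is the digit of letter [m]. *)
pose pref m := flatten [seq nseq (digit B E a) a | a : 'I_k <- take m (enum 'I_k)].
apply: wp_seq; apply: wp_do.
apply: wp_mono; first apply: (wp_for (n := k) (I := fun m s' =>
  [/\ rg s' rCur = E %/ B ^ m, represents (cur s') (nfa_reach S (pref m)) & nxt s' =1 xpred0]))
  => //=.
- by rewrite expn0 divn1 /pref take0.
- move=> m s1 hm [s1C s1S s1n] s1A [fr1 _ _].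
  apply: wp_cat.
    apply: (@divide_prog_wp s1 (E %/ B ^ m) B) => //; last by rewrite (fr1 rB isT).
    exact: leq_trans (leq_div _ _) EX.
  move=> s2 [fr2 fc2 fn2] [s2E s2C].
  have {}s2n : nxt s2 =1 xpred0 by rewrite fn2.
  have s2S : represents (cur s2) (nfa_reach S (pref m)) by rewrite fc2.
  pose a := Ordinal hm.
  apply: wp_mono; first apply: (wp_for (n := digit B E m) (I := fun j s' =>
    represents (cur s') (nfa_reach S (pref m ++ nseq j a)) /\ nxt s' =1 xpred0)) => //=.
  + by apply: leq_trans BX; apply: ltnW; rewrite ltn_mod.
  + by rewrite cats0.
  + move=> j s3 hj [s3S s3n] _ [fr3 _ _].
    apply: wp_mono; first apply: (@step_prog_wp s3 a (nfa_reach S (pref m ++ nseq j a))) => //.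
    * by rewrite (fr3 rD0 isT) (fr2 rD0 isT) (fr1 rD0 isT).
    * by rewrite (fr3 rN isT) (fr2 rN isT) (fr1 rN isT).
    * by rewrite (fr3 rK isT) (fr2 rK isT) (fr1 rK isT).
    * by rewrite (fr3 rA isT) (fr2 rA isT).
    move=> s4 _ [s4S s4n]; split=> // p; rewrite [LHS](s4S p).
    have -> : a :: nseq j a = nseq j a ++ [:: a] by rewrite -(nseqD j 1) addn1.
    by rewrite catA [in RHS]nfa_reach_cat.
  move=> s3 [fr3 _ _] [s3S s3n]; split=> //=.
    by rewrite (fr3 rCur isT) s2C expnSr divnMA.
  rewrite /pref (take_nth a) ?size_enum_ord // map_rcons flatten_rcons.
  by rewrite [nth _ _ _](_ : _ = a) //; apply: val_inj; rewrite /= nth_enum_ord.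
move=> s1 _ [_ s1S _]; move: s1S.
by rewrite /pref take_oversize // size_enum_ord.
Qed.

Hypothesis final_bits : forall p (hp : p < n), (inp (f0 + p) == 2) = (Ordinal hp \in nfa_final A).

Lemma final_prog_wp s S b :
  rg s rF = f0 -> rg s rN = n -> rg s rZ = 0 -> rg s rBad = b -> represents (cur s) S ->
  wp final_prog s (fun s' => rg s' rBad = b + ~~ [exists p in S, p \in nfa_final A]).
Proof.
move=> sF sN sZ sb sS; apply: wp_seq; apply: wp_do.
pose acc m := has (fun p => (inp (f0 + p) == 2) && cur s p) (iota 0 m).
have accS m : acc m.+1 = acc m || (inp (f0 + m) == 2) && cur s m.
  by rewrite /acc -[m.+1]addn1 iotaD has_cat /= orbF.
apply: wp_cat.
  apply: (wp_for (n := n) (I := fun m s' => rg s' rF = f0 + m /\ (0 < rg s' rOk) = acc m))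
    => //=.
    by rewrite addn0.
  move=> m s1 hm [s1F s1Ok] s1P [fr1 fc1 _].
  have s1c : cur s1 = cur s by rewrite fc1.
  apply: (@wp_cat _ _ _ _ _ _ (fun s' => rg s' rF = f0 + m /\ (0 < rg s' rOk) = acc m.+1)).
    apply: wp_if; rewrite /= s1F => h; last first.
      by apply: wp_do; rewrite accS (negPf h) orbF.
    apply: wp_if; rewrite /= s1c s1P => h'; last first.
      by apply: wp_do; rewrite accS (negPf h') andbF orbF.
    by apply: wp_do; rewrite accS h h' orbT.
  by move=> s2 _ [s2F s2Ok]; apply: wp_do; rewrite /= s2F addnS.
move=> s1 [fr1 _ _] [_ s1Ok].
have s1Z : rg s1 rZ = 0 by rewrite (fr1 rZ isT).
have s1b : rg s1 rBad = b by rewrite (fr1 rBad isT).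
have -> : [exists p in S, p \in nfa_final A] = acc n.
  apply/existsP/hasP => [[p /andP [pS pF]]|[p]].
    exists (val p); first by rewrite mem_iota add0n ltn_ord.
    rewrite sS pS andbT (final_bits (ltn_ord p)) (_ : Ordinal _ = p) //.
    exact: val_inj.
  rewrite mem_iota add0n => /andP [_ hp] /andP [pF pS]; exists (Ordinal hp).
  by rewrite -final_bits pF -(sS (Ordinal hp)) pS.
apply: wp_if; rewrite /= s1Z -leqn0 leqNgt s1Ok => h; apply: wp_do => /=; rewrite s1b.
  by rewrite h addn1.
by rewrite (negbNE h) addn0.
Qed.

Hypothesis count_bits : forall j, j < n -> inp (d + j) = 2.
Hypothesis count_end : inp (d + n) = 3.
Hypothesis init_bits : forall j, j < nfa_init A -> inp (d + n.+1 + j) = 2.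
Hypothesis init_end : inp (d + n.+1 + nfa_init A) = 3.
Hypothesis f0E : f0 = d + n.+1 + (nfa_init A).+1.
Hypothesis final_only : forall j, j < n -> inp (f0 + j) != 3.
Hypothesis final_end : inp (f0 + n) = 3.
Hypothesis d0E : d0 = f0 + n.+1.
Hypothesis delta_only : forall j, j < n * k * n -> inp (d0 + j) != 3.
Hypothesis delta_end : inp (d0 + n * k * n) = 3.
Hypothesis deltaX : n * k * n <= X.

Lemma nfa_prog_wp s b :
  0 < B -> B <= X -> E <= X ->
  rg s rE = E -> rg s rB = B -> rg s rK = k -> rg s rZ = 0 -> rg s rD = d -> rg s rBad = b ->
  wp nfa_prog s (fun s' =>
    rg s' rD = d0 + (n * k * n).+1 /\
    rg s' rBad = b + ~~ [exists p in nfa_reach [set nfa_init A] (digit_word k B E), p \in nfa_final A]).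
Proof.
move=> B0 BX EX sE sB sK sZ sD sb.
apply: wp_cat.
  by apply: (@count_prog_wp rN s d n) => //; [left|rewrite count_end].
move=> s1 [fr1 _ _] [s1N s1D].
apply: wp_cat.
  apply: (@count_prog_wp rQ s1 (d + n.+1) (nfa_init A)) => //; first by right.
    by apply: leq_trans nX; apply: ltnW.
  by rewrite init_end.
move=> s2 [fr2 _ _] [s2Q s2D].
do 4!(apply: wp_seq; apply: wp_do).
set s3 := exec_op _ _.
have s3S : represents (cur s3) [set nfa_init A].
  by move=> p; rewrite /= s2Q inE -val_eqE orbF.
apply: wp_cat.
  apply: (@jump_prog_wp s3 f0 n) => //.
  by rewrite /= s2D f0E.
move=> s4 [fr4 fc4 fn4] s4D; apply: wp_seq; apply: wp_do.
apply: wp_cat.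
  apply: (@word_prog_wp _ [set nfa_init A]) => //=.
  - by rewrite (fr4 rE isT) /= (fr2 rE isT) (fr1 rE isT).
  - by rewrite (fr4 rB isT) /= (fr2 rB isT) (fr1 rB isT).
  - by rewrite s4D d0E.
  - by rewrite (fr4 rN isT) /= (fr2 rN isT).
  - by rewrite (fr4 rK isT) /= (fr2 rK isT) (fr1 rK isT).
  - by rewrite fc4.
  - by rewrite fn4.
move=> s5 [fr5 _ _] s5S; apply: wp_seq; apply: wp_do.
apply: wp_cat.
  apply: (@jump_prog_wp _ d0 (n * k * n)) => //.
  by rewrite /= (fr5 rD0 isT) /= s4D d0E.
move=> s6 [fr6 fc6 _] s6D.
apply: wp_mono; first apply: (@final_prog_wp _ (nfa_reach [set nfa_init A] (digit_word k B E)) b).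
- by rewrite (fr6 rF isT) /= (fr5 rF isT) /= (fr4 rF isT) /= s2D f0E.
- by rewrite (fr6 rN isT) /= (fr5 rN isT) /= (fr4 rN isT) /= (fr2 rN isT).
- by rewrite (fr6 rZ isT) /= (fr5 rZ isT) /= (fr4 rZ isT) /= (fr2 rZ isT) (fr1 rZ isT).
- by rewrite (fr6 rBad isT) /= (fr5 rBad isT) /= (fr4 rBad isT) /= (fr2 rBad isT) (fr1 rBad isT).
- by rewrite fc6.
by move=> s7 [fr7 _ _] ->; rewrite (fr7 rD isT).
Qed.

End OneAutomaton.

End Programs.

(** * The encoding of automata *)

Lemma inp_block (pre u post : seq 'I_3) j : j < size u ->
  inp (pre ++ u ++ post) (size pre + j) = (nth c0 u j).+1.
Proof.
move=> hj; rewrite /inp !map_cat nth_cat size_map ltnNge leq_addr addKn nth_cat size_map hj.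
by rewrite [~~ true]/= (nth_map c0 0 (fun a : 'I_3 => (val a).+1) hj).
Qed.

Lemma nth_flatten_uniform (S : Type) (T : eqType) (x0 : T) (g : S -> seq T) c (d : S) (s : seq S) i r :
  (forall x, size (g x) = c) -> i < size s -> r < c ->
  nth x0 (flatten [seq g x | x <- s]) (i * c + r) = nth x0 (g (nth d s i)) r.
Proof.
move=> hg; elim: s i => // x s IH [|i] hi hr /=; rewrite nth_cat hg.
  by rewrite mul0n add0n hr.
by rewrite mulSn -addnA ltnNge leq_addr /= addKn IH.
Qed.

Lemma size_flatten_uniform (S T : Type) (g : S -> seq T) c (s : seq S) :
  (forall x, size (g x) = c) -> size (flatten [seq g x | x <- s]) = size s * c.
Proof. by move=> hg; elim: s => //= x s IH; rewrite size_cat hg IH mulSn. Qed.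

Lemma nth_enum_Ordinal m (i : nat) (hi : i < m) (d : 'I_m) : nth d (enum 'I_m) i = Ordinal hi.
Proof. by apply: val_inj; rewrite /= nth_enum_ord. Qed.

Section Encoding.

Variables (k : nat) (A : nfa k).
Local Notation n := (nfa_n A).+1.

Definition final_row : seq 'I_3 := [seq cbit (q \in nfa_final A) | q <- enum 'I_n].

Definition delta_rows : seq 'I_3 :=
  flatten [seq [seq cbit (p \in nfa_delta q a) | a <- enum 'I_k, p <- enum 'I_n] | q <- enum 'I_n].

Lemma size_final_row : size final_row = n.
Proof. by rewrite size_map size_enum_ord. Qed.

Lemma size_delta_row q :
  size [seq cbit (p \in nfa_delta q a) | a <- enum 'I_k, p <- enum 'I_n] = k * n.
Proof. by rewrite size_allpairs !size_enum_ord. Qed.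

Lemma size_delta_rows : size delta_rows = n * k * n.
Proof.
by rewrite (size_flatten_uniform _ size_delta_row) size_enum_ord mulnA.
Qed.

Lemma nth_delta_rows q a p (hq : q < n) (ha : a < k) (hp : p < n) :
  nth c0 delta_rows ((q * k + a) * n + p) =
  cbit (Ordinal hp \in nfa_delta (Ordinal hq) (Ordinal ha)).
Proof.
rewrite mulnDl -mulnA -addnA.
rewrite (nth_flatten_uniform _ (Ordinal hq) size_delta_row) ?size_enum_ord //; last first.
  by rewrite -addnS (leq_trans (leq_add (leqnn _) hp)) // addnC -mulSn leq_mul2r ha orbT.
rewrite (nth_flatten_uniform _ (Ordinal ha) (c := n)) ?size_enum_ord //; last first.
  by move=> x; rewrite size_map size_enum_ord.
by rewrite (nth_map (Ordinal hp)) ?size_enum_ord // !nth_enum_Ordinal.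
Qed.

Lemma cbit_code b : ((cbit b).+1 == 2) = b /\ (cbit b).+1 != 3.
Proof. by case: b. Qed.

Lemma enc_nfaE (pre post : seq 'I_3) :
  pre ++ enc_nfa A ++ post = pre ++ unary n ++ [:: csep] ++ unary (nfa_init A) ++ [:: csep] ++
    final_row ++ [:: csep] ++ delta_rows ++ [:: csep] ++ post.
Proof. by rewrite /enc_nfa -!catA. Qed.

Lemma size_enc_nfa : size (enc_nfa A) = n.+1 + (nfa_init A).+1 + n.+1 + (n * k * n).+1.
Proof.
have := congr1 size (enc_nfaE [::] [::]).
rewrite cats0 !size_cat /= !size_nseq size_final_row size_delta_rows; lia.
Qed.

Lemma nfa_prog_spec (pre post : seq 'I_3) X B E s b :
  let w := pre ++ enc_nfa A ++ post in
  size w <= X -> k <= X -> 0 < B -> B <= X -> E <= X ->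
  rg s rE = E -> rg s rB = B -> rg s rK = k -> rg s rZ = 0 -> rg s rD = size pre ->
  rg s rBad = b ->
  wp w X nfa_prog s (fun s' =>
    rg s' rD = size pre + size (enc_nfa A) /\
    rg s' rBad = b + ~~ [exists p in nfa_reach [set nfa_init A] (digit_word k B E), p \in nfa_final A]).
Proof.
move=> w wX kX B0 BX EX sE sB sK sZ sD sb.
have encX : size (enc_nfa A) <= X by move: wX; rewrite !size_cat; lia.
have ew := enc_nfaE pre post; rewrite -/w in ew.
pose f0 := size pre + n.+1 + (nfa_init A).+1; pose d0 := f0 + n.+1.
(* The input is cut in front of each block and each separator in turn, so that [inp_block] can read
   it off. *)
have e1 : w = (pre ++ unary n) ++ [:: csep] ++ unary (nfa_init A) ++ [:: csep] ++
    final_row ++ [:: csep] ++ delta_rows ++ [:: csep] ++ post by rewrite ew -!catA.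
have e2 : w = (pre ++ unary n ++ [:: csep]) ++ unary (nfa_init A) ++ [:: csep] ++
    final_row ++ [:: csep] ++ delta_rows ++ [:: csep] ++ post by rewrite ew -!catA.
have e3 : w = (pre ++ unary n ++ [:: csep] ++ unary (nfa_init A)) ++ [:: csep] ++
    final_row ++ [:: csep] ++ delta_rows ++ [:: csep] ++ post by rewrite ew -!catA.
have e4 : w = (pre ++ unary n ++ [:: csep] ++ unary (nfa_init A) ++ [:: csep]) ++
    final_row ++ [:: csep] ++ delta_rows ++ [:: csep] ++ post by rewrite ew -!catA.
have e5 : w = (pre ++ unary n ++ [:: csep] ++ unary (nfa_init A) ++ [:: csep] ++ final_row) ++
    [:: csep] ++ delta_rows ++ [:: csep] ++ post by rewrite ew -!catA.
have e6 : w = (pre ++ unary n ++ [:: csep] ++ unary (nfa_init A) ++ [:: csep] ++ final_row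
    ++ [:: csep]) ++ delta_rows ++ [:: csep] ++ post by rewrite ew -!catA.
have e7 : w = (pre ++ unary n ++ [:: csep] ++ unary (nfa_init A) ++ [:: csep] ++ final_row
    ++ [:: csep] ++ delta_rows) ++ [:: csep] ++ post by rewrite ew -!catA.
have block (x u y : seq 'I_3) o j : w = x ++ u ++ y -> size x = o -> j < size u ->
    inp w (o + j) = (nth c0 u j).+1 by move=> -> <-; apply: inp_block.
have sep (x y : seq 'I_3) o : w = x ++ [:: csep] ++ y -> size x = o -> inp w o = 3.
  by move=> ex eo; rewrite -[o]addn0 (block _ _ _ _ _ ex eo).
have sz := (size_cat, size_final_row, size_delta_rows, size_nseq).
have B1 j : j < n -> inp w (size pre + j) = 2.
  by move=> hj; rewrite (block _ _ _ _ _ ew) ?size_nseq // nth_nseq hj.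
have S1 : inp w (size pre + n) = 3 by apply: sep e1 _; rewrite !sz.
have B2 j : j < nfa_init A -> inp w (size pre + n.+1 + j) = 2.
  move=> hj; rewrite (block _ _ _ _ _ e2) ?size_nseq ?nth_nseq ?hj //.
  by rewrite !sz /=; lia.
have S2 : inp w (size pre + n.+1 + nfa_init A) = 3.
  by apply: sep e3 _; rewrite !sz /=; lia.
have B3 j : j < n -> inp w (f0 + j) = (nth c0 final_row j).+1.
  by move=> hj; apply: block e4 _ _; rewrite ?sz // /f0 /=; lia.
have S3 : inp w (f0 + n) = 3.
  by apply: sep e5 _; rewrite !sz /f0 /=; lia.
have B4 j : j < n * k * n -> inp w (d0 + j) = (nth c0 delta_rows j).+1.
  by move=> hj; apply: block e6 _ _; rewrite ?sz // /d0 /f0 /=; lia.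
have S4 : inp w (d0 + n * k * n) = 3.
  by apply: sep e7 _; rewrite !sz /d0 /f0 /=; lia.
have size_enc := size_enc_nfa.
apply: wp_mono; first apply: (@nfa_prog_wp w X k A (size pre) f0 d0 B E) => //.
- by rewrite size_enc in encX; lia.
- move=> q p a hq ha hp; rewrite -addnA B4 ?nth_delta_rows ?(cbit_code _).1 //.
  have : q * k + a < n * k by nia.
  nia.
- move=> p hp; rewrite B3 // (nth_map (Ordinal hp)) ?size_enum_ord //.
  by rewrite nth_enum_Ordinal (cbit_code _).1.
- move=> j hj; rewrite B3 // (nth_map (Ordinal hj)) ?size_enum_ord //.
  by rewrite (cbit_code _).2.
- move=> j hj; rewrite B4 //.
  have : nth c0 delta_rows j \in delta_rows by rewrite mem_nth ?size_delta_rows.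
  by case/flatten_mapP => q _ /allpairsP [[a p] [_ _ ->]]; rewrite (cbit_code _).2.
- by rewrite size_enc in encX; lia.
move=> s' _ [h1 h2]; split; last by rewrite h2 sb.
by rewrite h1 size_enc /d0 /f0; lia.
Qed.

End Encoding.

Lemma take_succ (T : Type) (s : seq T) i : i < size s ->
  exists2 x, take i.+1 s = rcons (take i s) x & s = take i s ++ x :: drop i.+1 s.
Proof.
elim: s i => //= x s IH [|i] hi; first by exists x; rewrite ?take0 ?drop0.
by have [y e1 e2] := IH i hi; exists y; rewrite /= ?e1 //; congr (_ :: _).
Qed.

(** Bounds the rounds of the loop over the automata: no code is empty. *)
Lemma size_le_encode k (As : seq (nfa k)) : size As <= size (encode As).
Proof.
rewrite /encode !size_cat addnA; apply: leq_trans (leq_addl _ _).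
elim: As => // A s IH; rewrite -[flatten _]/(enc_nfa A ++ flatten (map (@enc_nfa k) s)) size_cat.
rewrite -[size (A :: s)]add1n leq_add //; by rewrite size_enc_nfa addnS.
Qed.

Definition accepts k (B E : nat) (A : nfa k) : bool :=
  [exists p in nfa_reach [set nfa_init A] (digit_word k B E), p \in nfa_final A].

Definition found k (As : seq (nfa k)) (B m : nat) : bool :=
  has (fun E => all (accepts B E) As) (iota 0 m).

(** * Correctness of the search *)

Section Search.

Variables (k : nat) (As : seq (nfa k)) (X : nat).
Local Notation w := (encode As).
Local Notation N := (size w).
(** Every automaton has at most [N] states, so this exceeds all their thresholds at once. *)
Local Notation B := (2 * N ^ 2).+1.

Hypothesis NX : N <= X.
Hypothesis BX : B <= X.
Hypothesis BkX : B ^ k <= X.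

Definition prefix i := unary k ++ [:: csep] ++ flatten (map (@enc_nfa k) (take i As)).

Lemma k_le_size : k < N.
Proof. by rewrite /encode !size_cat size_nseq addnA addn1 leq_addr. Qed.

Lemma prefix_split i A : take i.+1 As = rcons (take i As) A ->
  As = take i As ++ A :: drop i.+1 As ->
  prefix i.+1 = prefix i ++ enc_nfa A /\
  w = prefix i ++ enc_nfa A ++ flatten (map (@enc_nfa k) (drop i.+1 As)).
Proof.
move=> e1 e2.
have cat3 (a b c d : seq 'I_3) : a ++ b ++ c ++ d = (a ++ b ++ c) ++ d by rewrite -!catA.
split; first by rewrite /prefix e1 map_rcons flatten_rcons; apply: cat3.
have eF : flatten (map (@enc_nfa k) As) =
    flatten (map (@enc_nfa k) (take i As)) ++
    (enc_nfa A ++ flatten (map (@enc_nfa k) (drop i.+1 As))).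
  by rewrite {1}e2 map_cat flatten_cat.
by rewrite /encode eF; apply: cat3.
Qed.

Lemma inp_end : inp w N = 0.
Proof. by rewrite /inp nth_default ?size_map. Qed.

Lemma check_prog_wp s E : E <= X ->
  rg s rE = E -> rg s rB = B -> rg s rK = k -> rg s rZ = 0 ->
  wp w X check_prog s (fun s' => (rg s' rBad == 0) = all (accepts B E) As).
Proof.
move=> EX sE sB sK sZ; do 3!(apply: wp_seq; apply: wp_do).
apply: wp_mono; first apply: (wp_while (n := size As) (I := fun i s' =>
  rg s' rD = size (prefix i) /\ (rg s' rBad == 0) = all (accepts B E) (take i As))).
- exact: leq_trans (size_le_encode As) NX.
- by rewrite /= sK /prefix take0 /= size_cat size_nseq addn1.
- move=> i s1 hi [s1D s1b] [fr1 _ _].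
  have [A eA1 eA2] := take_succ hi; have [eP ew] := prefix_split eA1 eA2.
  split.
    (* The pointer stands on an input symbol, not on the blank that ends the loop. *)
    have enc0 : 0 < size (enc_nfa A) by rewrite size_enc_nfa addnS.
    by rewrite [LHS]/= s1D ew -[size (prefix i)]addn0 inp_block.
  apply: wp_mono; first rewrite {1}ew.
    apply: (@nfa_prog_spec k A _ _ X B E s1 (rg s1 rBad)); rewrite -?ew //.
    + by apply: leq_trans (ltnW k_le_size) NX.
    + by rewrite (fr1 rE isT).
    + by rewrite (fr1 rB isT).
    + by rewrite (fr1 rK isT).
    + by rewrite (fr1 rZ isT).
  move=> s2 _ [s2D s2b]; rewrite s2D eP size_cat; split=> //.
  by rewrite s2b eA1 all_rcons addn_eq0 s1b andbC /accepts eqb0 negbK.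
- move=> s1 [s1D _] _; rewrite /= s1D.
  have -> : size (prefix (size As)) = N by rewrite /prefix take_size.
  by rewrite inp_end.
by move=> s1 _ [_ ->]; rewrite take_size.
Qed.

Lemma setup_prog_wp :
  wp w X setup_prog (store0 reg) (fun s =>
    [/\ rg s rK = k, rg s rB = B & rg s rBK = B ^ k]).
Proof.
have kN := k_le_size.
apply: wp_cat.
  apply: (wp_while (n := k) (I := fun i s => rg s rK = i)) => //.
  - by apply: leq_trans (ltnW kN) NX.
  - move=> i s hi si _; split; last by apply: wp_do; rewrite /= si.
    rewrite /= si -[i]add0n -[0]/(size (@nil 'I_3)).
    by rewrite /encode -[unary k ++ _]cat0s inp_block ?size_nseq // nth_nseq hi.
  - move=> s sk _; rewrite /= sk /encode -[k in inp _ k](size_nseq k c1) -[size _]addn0.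
    by rewrite inp_block.
move=> s1 [fr1 _ _] s1K.
apply: wp_cat.
  apply: (wp_while (n := N) (I := fun i s => rg s rLen = i)) => //.
  - by rewrite (fr1 rLen isT).
  - move=> i s hi si _; split; last by apply: wp_do; rewrite /= si.
    by rewrite /= si; apply/negbTE; rewrite -lt0n inp_gt0.
  - by move=> s si _; rewrite /= si inp_end.
move=> s2 [fr2 _ _] s2L; apply: wp_seq; apply: wp_do.
apply: wp_cat.
  apply: (wp_for (n := N) (I := fun i s => rg s rB = (2 * (i * N)).+1)) => //=.
    by rewrite (fr2 rB isT) (fr1 rB isT).
  move=> i s3 hi s3B _ [fr3 _ _].
  apply: wp_mono; first apply: (wp_for (n := N) (I := fun j s => rg s rB = (2 * (i * N + j)).+1))
    => //=.
  - by rewrite (fr3 rLen isT).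
  - by rewrite addn0.
  - move=> j s4 hj s4B _ _; apply: wp_seq; apply: wp_do; apply: wp_do; rewrite /= s4B; lia.
  by move=> s4 _ s4B; rewrite (mulSnr i); exact: s4B.
move=> s3 [fr3 _ _] s3B; apply: wp_seq; apply: wp_do.
have {}s3B : rg s3 rB = B by rewrite s3B expnS expn1.
have s3K : rg s3 rK = k by rewrite (fr3 rK isT) /= (fr2 rK isT).
apply: wp_mono; first apply: (wp_for (n := k) (I := fun i s => rg s rBK = B ^ i)) => //=.
- by apply: leq_trans (ltnW kN) NX.
- by rewrite (fr3 rBK isT) /= (fr2 rBK isT) (fr1 rBK isT).
- move=> i s4 hi s4BK _ [fr4 _ _]; apply: wp_seq; apply: wp_do.
  have powX : B ^ i <= X by apply: leq_trans BkX; rewrite leq_pexp2l // ltnW.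
  apply: wp_cat.
    apply: (wp_for (n := B ^ i) (I := fun j s => rg s rT = j * B)) => //=.
    move=> j s5 hj s5T _ [fr5 _ _].
    apply: wp_mono; first apply: (wp_for (n := B) (I := fun l s => rg s rT = j * B + l)) => //=.
    + by rewrite (fr5 rB isT) /= (fr4 rB isT).
    + by rewrite addn0.
    + by move=> l s6 hl s6T _ _; apply: wp_do; rewrite /= s6T addnS.
    by move=> s6 _ s6T; rewrite (mulSnr j); exact: s6T.
  by move=> s5 _ s5T; apply: wp_do; rewrite /= s5T -expnSr.
move=> s4 [fr4 _ _] s4BK; split=> //; first by rewrite (fr4 rK isT).
by rewrite (fr4 rB isT).
Qed.

(** Stated as the outcome of the test [Eq rFound rZ], which the decision program performs last. *)
Lemma search_prog_wp :
  wp w X search_prog (store0 reg) (fun s =>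
    (rg s rFound == rg s rZ) = ~~ found As B (B ^ k)).
Proof.
apply: wp_cat setup_prog_wp _ => s1 [fr1 _ _] [s1K s1B s1BK].
have s1Z : rg s1 rZ = 0 by rewrite (fr1 rZ isT).
apply: wp_mono; first apply: (wp_for (n := B ^ k) (I := fun E s =>
  (rg s rFound == 0) = ~~ found As B E)) => //=.
- by rewrite (fr1 rFound isT).
- move=> E s2 hE s2F s2E [fr2 _ _].
  apply: wp_cat.
    apply: (@check_prog_wp s2 E) => //.
    + by apply: leq_trans BkX; apply: ltnW.
    + by rewrite (fr2 rB isT).
    + by rewrite (fr2 rK isT).
    + by rewrite (fr2 rZ isT).
  move=> s3 [fr3 _ _] s3b.
  have s3Z : rg s3 rZ = 0 by rewrite (fr3 rZ isT) (fr2 rZ isT).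
  have foundS : found As B E.+1 = found As B E || all (accepts B E) As.
    by rewrite /found -[E.+1]addn1 iotaD has_cat /= orbF.
  apply: wp_if; rewrite /= s3Z s3b foundS => h; apply: wp_do => /=.
    by rewrite h orbT.
  by rewrite (negPf h) orbF (fr3 rFound isT).
by move=> s2 [fr2 _ _]; rewrite (fr2 rZ isT) s1Z.
Qed.

End Search.

(** * The exponent as a computable function *)

Variant phase := Scan | OverOutput | OverMarks | Halt | Dead.

Definition phase_code (r : phase) : nat :=
  match r with Scan => 0 | OverOutput => 1 | OverMarks => 2 | Halt => 3 | Dead => 4 end.

Definition phase_list : seq phase := [:: Scan; OverOutput; OverMarks; Halt; Dead].
Lemma phase_codeK : cancel phase_code (nth Scan phase_list). Proof. by case. Qed.
HB.instance Definition _ := Countable.copy phase (can_type phase_codeK).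
Lemma phase_enumP : Finite.axiom phase_list. Proof. by case. Qed.
HB.instance Definition _ := isFinite.Build phase phase_enumP.

Lemma nseqS_cat (T : Type) n (x : T) l : nseq n.+1 x ++ l = nseq n x ++ x :: l.
Proof. by elim: n => //= n ->. Qed.

Section Linear.

Variable m : nat.
Local Notation c := m.+1.

Definition lstate : finType := (phase + bool * 'I_c.+1)%type.

Definition lblank : 'I_4 := ord0.
Definition lmark : 'I_4 := inord 1.
Definition lone : 'I_4 := inord 2.

(* Every input symbol 1, and the first blank after the input, is replaced by a mark, and for
   each mark [c] symbols 1 are written to the left of the tape.  In state [inr (b, j)] the head
   looks for a blank to the left and has [j] symbols to write; [b] tells the last round. *)
Definition ldelta (q : lstate) (x : 'I_4) : lstate * 'I_4 * move :=
  match q with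
  | inr (b, j) =>
    if x != lblank then (q, x, MLeft)
    else if j == 0 :> nat then
      if b then (inl Halt, x, MStay) else (inl OverOutput, x, MRight)
    else (inr (b, inord j.-1), lone, MLeft)
  | inl Scan => (inr (x != lone, ord_max), lmark, MLeft)
  | inl OverOutput => if x == lone then (q, x, MRight) else (inl OverMarks, x, MStay)
  | inl OverMarks => if x == lmark then (q, x, MRight) else (inl Scan, x, MStay)
  | inl _ => (q, x, MStay)
  end.

Definition encl (q : lstate) : 'I_#|lstate|.+1 := inord (enum_rank q).
Definition decl (i : 'I_#|lstate|.+1) : lstate := nth (inl Dead) (enum lstate) i.

Lemma enclK : cancel encl decl.
Proof.
move=> q; rewrite /decl /encl inordK; first exact: nth_enum_rank.
by apply: leq_trans (ltn_ord _) _.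
Qed.

Definition linear_machine : TM :=
  @MkTM #|lstate| 0 (encl (inl Scan)) (encl (inl Halt)) (encl (inl Dead))
    (fun q x => let: (q', y, mv) := ldelta (decl q) x in (encl q', y, mv)).

Lemma linear_step q l x r : q != inl Halt -> q != inl Dead ->
  @tm_step linear_machine (encl q, l, x, r) =
  let: (q', y, mv) := ldelta q x in
  match mv with
  | MStay => (encl q', l, y, r)
  | MLeft => if l is z :: l' then (encl q', l', z, y :: r)
             else (encl q', [::], lblank, y :: r)
  | MRight => if r is z :: r' then (encl q', y :: l, z, r')
              else (encl q', y :: l, lblank, [::])
  end.
Proof.
move=> h1 h2; rewrite /tm_step /= !(can_eq enclK) (negPf h1) (negPf h2) /= enclK.
by case: (ldelta q x) => [[q' y] []].
Qed.

(** Step counts are dropped, as [tm_computes] asks only for some halting time. *)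
Definition reaches (M : TM) (a b : tm_config M) : Prop := exists t, tm_run t a = b.

Lemma reaches_trans M (a b d : tm_config M) : reaches a b -> reaches b d -> reaches a d.
Proof. by case=> t <- [u <-]; exists (t + u); rewrite tm_runD. Qed.

Lemma reaches_step M (a b : tm_config M) : reaches (tm_step a) b -> reaches a b.
Proof. by apply: reaches_trans; exists 1. Qed.

Lemma reaches_refl M (a : tm_config M) : reaches a a.
Proof. by exists 0. Qed.

Local Notation config q l x r := ((encl q, l, x, r) : tm_config linear_machine).

Lemma markE : ((lmark == lblank) = false) * ((lone == lblank) = false) *
  ((lmark == lone) = false) * ((lone == lmark) = false).
Proof. by do !split; rewrite -!val_eqE /= ?inordK. Qed.

Lemma go_left b j l z x r : x != lblank -> all (predC1 lblank) l -> z = [::] \/ z = [:: lblank] ->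
  reaches (config (inr (b, j)) (l ++ z) x r) (config (inr (b, j)) [::] lblank (rev l ++ x :: r)).
Proof.
elim: l x r => [|y l IH] x r hx /= hl hz; apply: reaches_step; rewrite linear_step //= hx.
  by case: hz => ->; apply: reaches_refl.
by case/andP: hl => hy hl; rewrite rev_cons cat_rcons; apply: IH.
Qed.

Lemma write_ones b j r : j <= c ->
  reaches (config (inr (b, inord j)) [::] lblank r)
          (config (inr (b, ord0)) [::] lblank (nseq j lone ++ r)).
Proof.
elim: j r => [|j IH] r hj.
  by rewrite [inord 0](_ : _ = ord0); [apply: reaches_refl | apply: val_inj; rewrite /= inordK].
apply: reaches_step; rewrite linear_step //= inordK //=.
by have := IH (lone :: r) (ltnW hj); rewrite -nseqS_cat.
Qed.

Lemma skip_right (q : lstate) (s : 'I_4) n l r :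
  q != inl Halt -> q != inl Dead -> ldelta q s = (q, s, MRight) ->
  reaches (config q l (head lblank (nseq n s ++ r)) (behead (nseq n s ++ r)))
          (config q (nseq n s ++ l) (head lblank r) (behead r)).
Proof.
move=> h1 h2 hq; elim: n l => [|n IH] l; first exact: reaches_refl.
apply: reaches_step; rewrite linear_step // hq (nseqS_cat n s l).
case: n IH => [|n] IH; last by apply: (IH (s :: l)).
by case: r IH => [|y r] IH; apply: (IH (s :: l)).
Qed.

(** The first run to the left leaves the stored tape; every later one finds the blank on which the
    previous round turned. *)
Definition edge (i : nat) : seq 'I_4 := if i == 0 then [::] else [:: lblank].

Definition scanning n i := config (inl Scan)
  (nseq i lmark ++ nseq (c * i) lone ++ edge i)
  (head lblank (nseq (n - i) lone)) (behead (nseq (n - i) lone)).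

Lemma produce b i x r : b = (x != lone) ->
  reaches (config (inl Scan) (nseq i lmark ++ nseq (c * i) lone ++ edge i) x r)
    (config (inr (b, ord0)) [::] lblank (nseq (c * i.+1) lone ++ nseq i.+1 lmark ++ r)).
Proof.
move=> hb; apply: reaches_step; rewrite linear_step // /ldelta -hb.
set a := nseq i lmark ++ nseq (c * i) lone.
have hz : edge i = [::] \/ edge i = [:: lblank] by rewrite /edge; case: eqP; [left | right].
have ha : all (predC1 lblank) a.
  by rewrite all_cat !all_nseq /= !markE !orbT.
apply: (@reaches_trans _ _
    (config (inr (b, ord_max)) [::] lblank (rev a ++ lmark :: r))).
  rewrite catA -/a; case ea: a ha => [|y l] /=.
    by move=> _; case: hz => ->; exact: reaches_refl.
  by case/andP=> hy hl; rewrite rev_cons cat_rcons; apply: go_left.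
have -> : ord_max = inord c :> 'I_c.+1 by apply: val_inj; rewrite /= inordK.
apply: reaches_trans (write_ones _ _ (leqnn c)) _.
have rn n (s : 'I_4) : rev (nseq n s) = nseq n s.
  by elim: n => //= n IH; rewrite rev_cons IH -cats1 -(nseqD n 1) addn1.
rewrite /a rev_cat !rn catA catA -nseqD -mulnS.
rewrite nseqS_cat.
by rewrite catA; apply: reaches_refl.
Qed.

Lemma scan_round n i : i < n -> reaches (scanning n i) (scanning n i.+1).
Proof.
move=> hi; rewrite /scanning subnS; case e: (n - i) => [|d]; first by lia.
apply: reaches_trans; first by apply: (@produce false); rewrite eqxx.
set r := behead _.
have e1 : nseq (c * i.+1) lone = lone :: nseq (i + m * i.+1) lone by [].
apply: reaches_step; rewrite linear_step // /ldelta eqxx.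
apply: (@reaches_trans _ _ (config (inl OverOutput) (nseq (c * i.+1) lone ++ [:: lblank])
    lmark (nseq i lmark ++ r))).
  have := @skip_right (inl OverOutput) lone (c * i.+1) [:: lblank] (lmark :: nseq i lmark ++ r).
  by rewrite e1 /= eqxx; apply.
apply: reaches_step; rewrite linear_step // /ldelta !markE.
apply: reaches_trans.
  have := @skip_right (inl OverMarks) lmark i.+1 (nseq (c * i.+1) lone ++ [:: lblank]) r.
  by rewrite /= eqxx; apply.
apply: reaches_step; rewrite linear_step // /ldelta.
have -> : (head lblank r == lmark) = false.
  by rewrite /r; case: (d) => [|d'] /=; rewrite ?markE // eq_sym markE.
exact: reaches_refl.
Qed.

(** The [n] input symbols have become marks, so the ones on the final tape are the output; the round
    on the blank after the input supplies the summand for [n.+1]. *)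
Lemma linear_machine_computes : tm_computes linear_machine (fun n => c * n.+1).
Proof.
move=> n; have start : @tm_init linear_machine (unary n) = scanning n 0.
  rewrite /tm_init /scanning muln0 subn0 /unary.
  have -> : map (@tm_in linear_machine) (nseq n c1) = nseq n lone.
    by rewrite map_nseq; congr (nseq n _); apply: val_inj; rewrite /= !inordK.
  by [].
have go i : i <= n -> reaches (scanning n 0) (scanning n i).
  elim: i => [|i IH] hi; first exact: reaches_refl.
  exact: reaches_trans (IH (ltnW hi)) (scan_round hi).
have fin : reaches (scanning n n) (config (inl Halt) [::] lblank
    (nseq (c * n.+1) lone ++ nseq n.+1 lmark)).
  rewrite /scanning subnn; apply: reaches_trans.
    by apply: (@produce true); rewrite eq_sym markE.
  apply: reaches_step; rewrite linear_step // /ldelta eqxx /= cats0; exact: reaches_refl.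
have [t ht] := reaches_trans (go n (leqnn n)) fin.
exists t; rewrite start ht; split=> //.
have -> : @tm_in linear_machine c1 = lone by apply: val_inj; rewrite /= !inordK.
rewrite -[tm_tape _]/([:: lblank] ++ nseq (c * n.+1) lone ++ nseq n.+1 lmark).
by rewrite !count_cat !count_nseq /= eqxx [lblank == lone]eq_sym !markE mul1n mul0n add0n addn0.
Qed.

End Linear.

(** * The decision machine and its running time *)

Definition decide_prog : prog reg := Seq search_prog (Do (Eq rFound rZ)).

Lemma all_InP (T : Type) (P : pred T) (s : seq T) :
  reflect (forall x, List.In x s -> P x) (all P s).
Proof.
elim: s => [|x s IH] /=; first by left.
apply: (iffP andP) => [[Px /IH h] y [<-|/h]|h] //; split; first by apply: h; left.
by apply/IH => y hy; apply: h; right.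
Qed.

Lemma nfa_size_le k (As : seq (nfa k)) A : List.In A As -> (nfa_n A).+1 <= size (encode As).
Proof.
move=> hA; have h : size (enc_nfa A) <= size (flatten (map (@enc_nfa k) As)).
  elim: As hA => // A' s IH hA.
  rewrite -[flatten _]/(enc_nfa A' ++ flatten (map (@enc_nfa k) s)) size_cat.
  case: hA => [->|/IH h]; first exact: leq_addr.
  exact: leq_trans h (leq_addl _ _).
rewrite size_enc_nfa in h; rewrite /encode !size_cat; lia.
Qed.

Lemma foundP k (As : seq (nfa k)) B :
  (forall A, List.In A As ->
    totally_star_free A /\ star_free (nfa_lang A) /\ commutative_lang (nfa_lang A)) ->
  (forall A, List.In A As -> 2 * (nfa_n A).+1 ^ 2 < B) -> 0 < B ->
  found As B (B ^ k) <-> exists w, forall A, List.In A As -> nfa_lang A w.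
Proof.
move=> hAs hB B0; split.
  by case/hasP => E _ /all_InP h; exists (digit_word k B E) => A /h.
case/(bounded_witness _ B0) => [A hA|E hE h].
  by have [h1 [_ h3]] := hAs A hA; split=> //; apply: hB.
by apply/hasP; exists E; [rewrite mem_iota | apply/all_InP].
Qed.

(* Each of the [n] operations is a sweep over at most [N + n] cells and back. *)
Lemma time_bound C D N k n f : 0 < N -> f = (6 * C.+1 ^ 2 + 8 * D.+1).+1 * k.+1 ->
  n <= C * ((2 * N ^ 2).+1 ^ k.+1).+1 ^ D + 1 ->
  n * (N + n).*2.+1 < f * N.+1 ^ f.
Proof.
move=> N0 fE hn.
(* The base [B] is at most [N.+1 ^ 3]; the fourth factor absorbs the successor in [X.+1]. *)
pose Y := N.+1 ^ (4 * k.+1).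
have Y1 : N.+1 <= Y by rewrite -{1}[N.+1]expn1 leq_pexp2l // mulnS.
have hX : ((2 * N ^ 2).+1 ^ k.+1).+1 <= Y.
  have h3 : (2 * N ^ 2).+1 <= N.+1 ^ 3 by rewrite !expnS expn0; nia.
  apply: (@leq_trans ((N.+1 ^ 3) ^ k.+1).+1); first by rewrite ltnS leq_exp2r.
  rewrite -expnM; apply: (@leq_trans (N.+1 ^ (3 * k.+1).+1)); first by rewrite ltn_exp2l.
  by rewrite leq_pexp2l //; lia.
(* A common bound for [n], [N] and [Y], which makes the time quadratic in [Z]. *)
pose Z := C.+1 * Y ^ D.+1.
have YD : 0 < Y ^ D by rewrite expn_gt0 (leq_trans _ Y1).
have nZ : n <= Z.
  apply: leq_trans hn _.
  rewrite addnC /Z (expnS Y) mulSn; apply: leq_add; first by rewrite muln_gt0 YD (leq_trans _ Y1).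
  rewrite leq_mul2l; apply/orP; right.
  apply: (@leq_trans (Y ^ D)); last by rewrite leq_pmull // (leq_trans _ Y1).
  by case: (D) => // D'; rewrite leq_exp2r.
have YZ : Y <= Z by rewrite /Z expnS; nia.
have hZ : n * (N + n).*2.+1 < 6 * Z ^ 2 by rewrite expnS expn1; nia.
apply: leq_trans hZ _; rewrite /Z expnMn mulnA leq_mul //.
  by rewrite fE; nia.
rewrite /Y -!expnM leq_pexp2l // fE; nia.
Qed.

Theorem theorem18 :
  exists (f : nat -> nat) (Mf M : TM),
    tm_computes Mf f /\ tm_acc M != tm_rej M /\
    forall (k : nat) (As : seq (nfa k)),
      (forall A, List.In A As ->
         totally_star_free A /\ star_free (nfa_lang A) /\ commutative_lang (nfa_lang A)) ->
      let N := size (encode As) in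
      let c := tm_run (f k * N.+1 ^ f k) (tm_init M (encode As)) in
      (tm_state c = tm_acc M \/ tm_state c = tm_rej M) /\
      (tm_state c = tm_acc M <->
         exists w : seq 'I_k, forall A, List.In A As -> nfa_lang A w).
Proof.
have [C [D hCD]] := tcost_poly search_prog.
(* The time is below [6 * C.+1 ^ 2] times [N.+1] to the power [8 * D.+1 * k.+1]; adding the two
   constants lets one number serve as factor and as exponent. *)
set m := 6 * C.+1 ^ 2 + 8 * D.+1.
exists (fun k => m.+1 * k.+1), (linear_machine m), (machine decide_prog).
split; first exact: linear_machine_computes.
split=> [|k As hAs N c]; first by rewrite /= (can_eq (@encqK _ _)).
set B := (2 * N ^ 2).+1; set X := B ^ k.+1.
have N0 : 0 < N by apply: leq_ltn_trans (k_le_size As).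
have BX : B <= X by rewrite -[B]expn1 leq_pexp2l.
have NX : N <= X by apply: leq_trans BX; rewrite /B; nia.
have BkX : B ^ k <= X by rewrite leq_pexp2l.
have [s ex hs] := search_prog_wp NX BX BkX.
have [n [r [hn fl]]] := exec_flow (isT : wf search_prog) ex.
(* The trailing test turns the result of the search into the last outcome; it fails, and the machine
   accepts, exactly when a word was found. *)
have fl2 : flow (encode As) (entry (Do (Eq rFound rZ))) s 1 s (~~ found As B (B ^ k)).
  by rewrite -hs; apply: (@flow_exit _ _ (Do (Eq rFound rZ)) tt).
have fl3 := flow_seq fl fl2.
have hn1 : n + 1 <= C * X.+1 ^ D + 1 by rewrite leq_add2r (leq_trans hn).
have ec := machine_halts N0 fl3 (time_bound N0 erefl hn1).
rewrite -/c in ec; have fP := foundP (B := B) hAs; rewrite ec /=; split.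
  by case: (found _ _ _); [left | right].
rewrite -fP // => [|A hA]; last by rewrite ltnS leq_mul2l leq_exp2r // nfa_size_le ?orbT.
split=> [/(can_inj (@encqK _ _))[]|->//].
by case: (found _ _ _).
Qed.
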